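(* Consider a sequence (indexed by $n\to\infty$) of stochastic block models with $n$ nodes, $k$ communities, true assignment $z^*\in[k]^n$, community sizes $n_1,\dots,n_k$, balance parameter $\beta=\frac{\min_{a\in[k]}n_a}{n/k}$ and connection probabilities $p,q$ (all of which may depend on $n$). Assume $\beta^{-1}=O(1)$, $k=O(1)$, $0<q<p\le 1/2$, and $\frac{n(p-q)^2}{p}\to\infty$. Let $\tilde A$ be the adjacency matrix trimmed at threshold $\tau=20np$, let $U\in\mathbb{R}^{n\times k}$ be its matrix of $k$ leading eigenvectors, with rows $U_{i\cdot}$, and let $\mathcal F$ be the event $\{\|\tilde A-\mathbb{E}A\|\le C_0\sqrt{np}\}$. Define $$t_0:=\frac{160k^2}{\beta}\sqrt{\frac{k}{\beta n}}.$$ Then, for all sufficiently large $n$, $$\mathbb{E}\left[\left(\sum_{i\in[n]}\|U_{i\cdot}\|^2\,\mathbb{I}\{\|U_{i\cdot}\|\ge t_0\}\right)\mathbb{I}\{\mathcal F\}\right]\le t_0^2\,n\exp\left(-\frac{3n(p-q)^2}{2p}\right).$$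
   Context: Notation: $[r]=\{1,\dots,r\}$; $\|\cdot\|$ is the Euclidean norm of vectors and the operator norm of matrices. Stochastic block model (SBM): $z^*\in[k]^n$ is a deterministic community assignment and $n_a=|\{i\in[n]:z^*_i=a\}|$. The adjacency matrix $A\in\{0,1\}^{n\times n}$ is a random symmetric matrix with zero diagonal whose entries $(A_{ij})_{1\le i<j\le n}$ are independent Bernoulli variables with $\mathbb{E}A_{ij}=p$ if $z^*_i=z^*_j$ and $\mathbb{E}A_{ij}=q$ otherwise. Trimmed matrix and eigenvectors: let $\tau=20np$ and $d_i=\sum_{j\ne i}A_{ij}$; $\tilde A_{ij}=A_{ij}$ if $d_i<\tau$ and $d_j<\tau$, and $\tilde A_{ij}=0$ otherwise. Let $\tilde A=\sum_{i\in[n]}\lambda_iu_iu_i^T$ with $\lambda_1\ge\dots\ge\lambda_n$ and orthonormal eigenvectors $u_i$; $U=(u_1,\dots,u_k)\in\mathbb{R}^{n\times k}$. Constant $C_0$: $C_0>0$ is an absolute constant, fixed once and for all, such that $\|\tilde A-\mathbb{E}A\|\le C_0\sqrt{np}$ holds with probability at least $1-2n^{-3}$ (the existence of such a constant is a known concentration result). *)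

(* Defs.v *)
From HB Require Import structures.
From mathcomp Require Import all_boot all_order all_algebra.
From mathcomp Require Import all_classical all_reals all_analysis.
Set Implicit Arguments.
Unset Strict Implicit.
Unset Printing Implicit Defensive.
Import Order.TTheory GRing.Theory Num.Theory.
Import numFieldNormedType.Exports.
Local Open Scope classical_set_scope.
Local Open Scope ring_scope.

(* The library norm on matrices is the sup norm, hence the explicit Euclidean
   and operator norms below. *)
Definition enorm {R : realType} {m n : nat} (x : 'M[R]_(m, n)) : R :=
  Num.sqrt (\sum_(i < m) \sum_(j < n) x i j ^+ 2).

Definition opnorm {R : realType} {m n : nat} (M : 'M[R]_(m, n)) : R :=
  sup [set enorm (M *m x) | x in [set x : 'cV[R]_n | enorm x <= 1]].

(* Mutual independence of the subfamily of X indexed by D. *)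
Definition mutually_independent {R : realType} {d : measure_display}
    {T : measurableType d} (P : probability T R) {I : finType}
    (D : {set I}) (X : I -> T -> R) : Prop :=
  forall (J : {set I}) (B : I -> set R), J \subset D ->
    (forall i, measurable (B i)) ->
    P [set w | forall i, i \in J -> B i (X i w)] =
    (\prod_(i in J) P (X i @^-1` B i))%E.

Definition random_matrix {R : realType} {d : measure_display}
    {T : measurableType d} {m n : nat} (M : T -> 'M[R]_(m, n)) : Prop :=
  forall i j, measurable_fun setT (fun w => M w i j).

Definition mean_mx {R : realType} {d : measure_display} {T : measurableType d}
    (P : probability T R) {m n : nat} (M : T -> 'M[R]_(m, n)) : 'M[R]_(m, n) :=
  \matrix_(i, j) fine ('E_P[fun w => M w i j])%E.

Section sbm.
Context {R : realType}.

(* A 0/1-valued variable is Bernoulli with parameter its expectation. *)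
Record is_sbm {d : measure_display} {T : measurableType d}
    (P : probability T R) (n k : nat) (z : 'I_n -> 'I_k) (p q : R)
    (A : T -> 'M[R]_n) : Prop := IsSbm {
  sbm_measurable : random_matrix A ;
  sbm_01 : forall w i j, A w i j = 0 \/ A w i j = 1 ;
  sbm_sym : forall w, (A w)^T = A w ;
  sbm_diag : forall w i, A w i i = 0 ;
  sbm_indep : mutually_independent P
    [set e : 'I_n * 'I_n | (e.1 < e.2)%N]%SET (fun e w => A w e.1 e.2) ;
  sbm_mean : forall i j : 'I_n, (i < j)%N ->
    ('E_P[fun w => A w i j] = (if z i == z j then p else q)%:E)%E }.

Definition comm_size (n k : nat) (z : 'I_n -> 'I_k) (a : 'I_k) : nat :=
  #|[set i | z i == a]%SET|.

(* Every community size is at most n, so the neutral element n does not affect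
   the minimum as soon as 0 < k. *)
Definition balance (n k : nat) (z : 'I_n -> 'I_k) : R :=
  (\big[minn/n]_(a < k) comm_size z a)%:R / (n%:R / k%:R).

Definition degree (n : nat) (A : 'M[R]_n) (i : 'I_n) : R :=
  \sum_(j < n | j != i) A i j.

Definition trim (n : nat) (tau : R) (A : 'M[R]_n) : 'M[R]_n :=
  \matrix_(i, j)
    (if (degree A i < tau) && (degree A j < tau) then A i j else 0).

Definition sbm_trim (n : nat) (p : R) (A : 'M[R]_n) : 'M[R]_n :=
  trim (20 * n%:R * p) A.

(* U consists of the first k columns of an orthonormal eigenbasis of M whose
   eigenvalues are sorted in nonincreasing order. If k > n, the columns of U
   beyond the n-th are unconstrained. *)
Definition leading_eigenvectors (n k : nat) (M : 'M[R]_n) (U : 'M[R]_(n, k)) :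
    Prop :=
  exists (V : 'M[R]_n) (lambda : 'I_n -> R),
    [/\ V^T *m V = 1%:M,
        M = \sum_(i < n) lambda i *: (col i V *m (col i V)^T),
        (forall i j : 'I_n, (i <= j)%N -> lambda j <= lambda i)
      & forall (j : 'I_k) (l : 'I_n), j = l :> nat -> col j U = col l V].

Definition conc_event {d : measure_display} {T : measurableType d}
    (P : probability T R) (C0 : R) (n : nat) (p : R) (A : T -> 'M[R]_n) :
    set T :=
  [set w | opnorm (sbm_trim p (A w) - mean_mx P A) <= C0 * Num.sqrt (n%:R * p)].

Definition concentration_constant (C0 : R) : Prop :=
  0 < C0 /\
  forall (n k : nat) (z : 'I_n -> 'I_k) (p q : R)
    (d : measure_display) (T : measurableType d) (P : probability T R)
    (A : T -> 'M[R]_n),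
    (0 < n)%N -> 0 < q -> q < p -> p <= 2^-1 -> is_sbm P z p q A ->
    ((1 - 2 * n%:R ^- 3)%:E <= P (conc_event P C0 p A))%E.

Definition row_threshold (n k : nat) (beta : R) : R :=
  160 * k%:R ^+ 2 / beta * Num.sqrt (k%:R / (beta * n%:R)).

End sbm.

(* Main.v *)
Require Import Defs.
From HB Require Import structures.
From mathcomp Require Import all_boot all_order all_algebra.
From mathcomp Require Import all_classical all_reals all_analysis.
From mathcomp Require Import ring lra.
From mathcomp Require Import measurable_realfun.
Set Implicit Arguments.
Unset Strict Implicit.
Unset Printing Implicit Defensive.
Import Order.TTheory GRing.Theory Num.Theory.
Import numFieldNormedType.Exports.
Local Open Scope classical_set_scope.
Local Open Scope ring_scope.

(** Let [E] be the trimmed adjacency matrix minus the block matrix of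
    connection probabilities. On the concentration event the eigenvector
    equation gives [U = G + E U Lambda^-1], where [G] is constant on
    communities and has small rows, so a row [i] with [|U_i| >= t0] must have a
    large noise term [(E U Lambda^-1)_i].

    Let [S] be the set of bad rows, [D] the set of trimmed vertices and [J] the
    remaining vertices. All bad rows are left out at once: among the graphs on
    the event that have the same [S], the same [D] and the same edges inside
    [J], fix one whose [|U_S|] is almost minimal and call its eigenvectors [Q].
    A Davis-Kahan argument shows that the column space of [U] is within
    [O(|U_S|)] of that of [Q], whence [|E_SJ Q_J| >= c lambda |U_S|]. Given [S]
    and [D], the matrix [Q_J] depends only on the edges inside [J], hence is
    independent of [E_SJ]; its rows are below [t0], since [S] is also the bad
    set of the representative, and almost all its mass sits on much smaller
    rows.

    Conditionally on [Q] the rows of [E_SJ Q_J] have Gaussian exponential moments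
    (trimming bounds their range), and the vertices of [D] have an exponentially
    unlikely degree, so that summing over all pairs [(S, D)] bounds an
    exponential moment of the bad mass [|U_S|^2]; the inequality
    [u <= h - 1 + exp (u - h)] turns it into the bound on the mean. *)

(** * Frobenius norm *)

Section Frobenius.
Context {R : realType}.

Lemma enorm_sqr m n (X : 'M[R]_(m, n)) :
  enorm X ^+ 2 = \sum_(i < m) \sum_(j < n) X i j ^+ 2.
Proof.
rewrite /enorm sqr_sqrtr //.
by apply: sumr_ge0 => i _; apply: sumr_ge0 => j _; exact: sqr_ge0.
Qed.

Lemma enorm_ge0 m n (X : 'M[R]_(m, n)) : 0 <= enorm X.
Proof. exact: sqrtr_ge0. Qed.

Lemma enorm0 m n : enorm (0 : 'M[R]_(m, n)) = 0.
Proof.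
apply/eqP; rewrite -sqrf_eq0 enorm_sqr big1 // => i _.
by rewrite big1 // => j _; rewrite mxE expr0n.
Qed.

Lemma enorm_eq0 m n (X : 'M[R]_(m, n)) : enorm X = 0 -> X = 0.
Proof.
move=> X0; apply/matrixP => i j; rewrite mxE.
have := enorm_sqr X; rewrite X0 expr0n /= => /esym/eqP.
rewrite psumr_eq0 => [/allP/(_ i (mem_index_enum _))/= /eqP/eqP|]; last first.
  by move=> a _; apply: sumr_ge0 => b _; exact: sqr_ge0.
rewrite psumr_eq0 => [/allP/(_ j (mem_index_enum _))/=|]; last first.
  by move=> b _; exact: sqr_ge0.
by rewrite sqrf_eq0 => /eqP.
Qed.

Lemma enorm_trmx m n (X : 'M[R]_(m, n)) : enorm X^T = enorm X.
Proof.
rewrite /enorm exchange_big /=; congr Num.sqrt.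
by apply: eq_bigr => i _; apply: eq_bigr => j _; rewrite mxE.
Qed.

Lemma enorm_sqr_tr m n (X : 'M[R]_(m, n)) : enorm X ^+ 2 = \tr (X^T *m X).
Proof.
rewrite enorm_sqr exchange_big /=; apply: eq_bigr => j _; rewrite mxE.
by apply: eq_bigr => i _; rewrite mxE expr2.
Qed.

Lemma enorm_rows m n (X : 'M[R]_(m, n)) :
  enorm X ^+ 2 = \sum_i enorm (row i X) ^+ 2.
Proof.
rewrite enorm_sqr; apply: eq_bigr => i _.
by rewrite enorm_sqr big_ord1; apply: eq_bigr => j _; rewrite mxE.
Qed.

Lemma enorm_cols m n (X : 'M[R]_(m, n)) :
  enorm X ^+ 2 = \sum_j enorm (col j X) ^+ 2.
Proof.
rewrite -enorm_trmx enorm_rows; apply: eq_bigr => i _.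
by rewrite -tr_col enorm_trmx.
Qed.

(** The quadratic polynomial [\sum_i (t * x i - y i) ^+ 2] in [t] is nonnegative at its minimizer
    [b / a]; if [a = 0] then [x] vanishes. *)
Lemma cauchy_schwarz (I : finType) (x y : I -> R) :
  (\sum_i x i * y i) ^+ 2 <= (\sum_i x i ^+ 2) * (\sum_i y i ^+ 2).
Proof.
set a := \sum_i x i ^+ 2; set c := \sum_i y i ^+ 2; set b := \sum_i _.
have a0 : 0 <= a by apply: sumr_ge0 => i _; exact: sqr_ge0.
have key t : 0 <= t ^+ 2 * a - 2 * t * b + c.
  have -> : t ^+ 2 * a - 2 * t * b + c = \sum_i (t * x i - y i) ^+ 2.
    rewrite /a /b /c !mulr_sumr -sumrB -big_split /=.
    by apply: eq_bigr => i _; ring.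
  by apply: sumr_ge0 => i _; exact: sqr_ge0.
case: (eqVneq a 0) => [a_eq0|aN0]; last first.
  have := key (b / a).
  have -> : (b / a) ^+ 2 * a - 2 * (b / a) * b + c = (a * c - b ^+ 2) / a by field.
  by rewrite pmulr_lge0 ?subr_ge0 // invr_gt0 lt0r aN0.
have x0 i : x i = 0.
  move: a_eq0 => /eqP; rewrite psumr_eq0 => [|j _]; last exact: sqr_ge0.
  by move=> /allP/(_ i (mem_index_enum _)) /=; rewrite sqrf_eq0 => /eqP.
by rewrite a_eq0 mul0r /b big1 ?expr0n // => i _; rewrite x0 mul0r.
Qed.

Lemma inner_le (m n : nat) (X Y : 'M[R]_(m, n)) :
  `|\tr (X^T *m Y)| <= enorm X * enorm Y.
Proof.
rewrite -(ler_pXn2r (n := 2)) ?nnegrE ?mulr_ge0 ?enorm_ge0 //.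
rewrite real_normK ?num_real // exprMn !enorm_sqr.
have -> : \tr (X^T *m Y) = \sum_(p : 'I_m * 'I_n) X p.1 p.2 * Y p.1 p.2.
  rewrite -(pair_bigA _ (fun i j => X i j * Y i j)) /= exchange_big /=.
  by apply: eq_bigr => j _; rewrite mxE; apply: eq_bigr => i _; rewrite mxE.
rewrite !pair_bigA /=; exact: cauchy_schwarz.
Qed.

Lemma enormD m n (X Y : 'M[R]_(m, n)) : enorm (X + Y) <= enorm X + enorm Y.
Proof.
rewrite -(ler_pXn2r (n := 2)) ?nnegrE ?addr_ge0 ?enorm_ge0 //.
have -> : enorm (X + Y) ^+ 2 =
    enorm X ^+ 2 + enorm Y ^+ 2 + 2 * \tr (X^T *m Y).
  have E : \tr (Y^T *m X) = \tr (X^T *m Y).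
    by rewrite -mxtrace_tr trmx_mul trmxK.
  rewrite !enorm_sqr_tr [(X + Y)^T]linearD /= mulmxDl !mulmxDr !mxtraceD E; ring.
have := le_trans (ler_norm _) (inner_le X Y); lra.
Qed.

Lemma enormZ m n a (X : 'M[R]_(m, n)) : enorm (a *: X) = `|a| * enorm X.
Proof.
apply/eqP; rewrite -(eqrXn2 (n := 2)) ?mulr_ge0 ?enorm_ge0 //.
rewrite exprMn real_normK ?num_real // !enorm_sqr mulr_sumr; apply/eqP.
apply: eq_bigr => i _; rewrite mulr_sumr; apply: eq_bigr => j _.
by rewrite mxE exprMn.
Qed.

Lemma enormN m n (X : 'M[R]_(m, n)) : enorm (- X) = enorm X.
Proof. by rewrite -scaleN1r enormZ normrN1 mul1r. Qed.

Lemma enormB m n (X Y : 'M[R]_(m, n)) : enorm (X - Y) <= enorm X + enorm Y.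
Proof. by rewrite -[enorm Y]enormN; exact: enormD. Qed.

Lemma enorm_mulmx m n o (X : 'M[R]_(m, n)) (Y : 'M[R]_(n, o)) :
  enorm (X *m Y) <= enorm X * enorm Y.
Proof.
rewrite -(ler_pXn2r (n := 2)) ?nnegrE ?mulr_ge0 ?enorm_ge0 // exprMn.
rewrite enorm_sqr (enorm_sqr X) mulr_suml; apply: ler_sum => i _.
rewrite -enorm_trmx (enorm_sqr Y^T) mulr_sumr; apply: ler_sum => j _.
rewrite mxE; apply: le_trans (cauchy_schwarz _ _) _.
by under [X in _ <= _ * X]eq_bigr do rewrite mxE.
Qed.

Lemma enorm_mul_ortho m n o (X : 'M[R]_(m, n)) (Q : 'M[R]_(o, n)) :
  Q^T *m Q = 1%:M -> enorm (X *m Q^T) = enorm X.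
Proof.
move=> QQ; apply/eqP; rewrite -(eqrXn2 (n := 2)) ?enorm_ge0 //; apply/eqP.
rewrite -enorm_trmx -(enorm_trmx X) !enorm_sqr_tr !trmx_mul !trmxK.
by rewrite -mulmxA (mulmxA Q^T) QQ mul1mx.
Qed.

Lemma enorm_ortho_mul m n o (X : 'M[R]_(n, m)) (Q : 'M[R]_(o, n)) :
  Q^T *m Q = 1%:M -> enorm (Q *m X) = enorm X.
Proof.
move=> QQ; rewrite -enorm_trmx trmx_mul enorm_mul_ortho ?enorm_trmx //.
Qed.

Lemma pythagoras m n o (X : 'M[R]_(o, m)) (Q : 'M[R]_(o, n)) :
  Q^T *m Q = 1%:M ->
  enorm X ^+ 2 = enorm (Q^T *m X) ^+ 2 + enorm (X - Q *m (Q^T *m X)) ^+ 2.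
Proof.
move=> QQ; rewrite !enorm_sqr_tr -mxtraceD; congr (\tr _).
rewrite [(X - _)^T]linearB /= !trmx_mul !trmxK mulmxBl !mulmxBr !mulmxA.
rewrite -(mulmxA _ Q^T Q) QQ mulmx1.
by rewrite addrC subrr subr0 subrK.
Qed.

Lemma bessel m n o (X : 'M[R]_(o, m)) (Q : 'M[R]_(o, n)) :
  Q^T *m Q = 1%:M -> enorm (Q^T *m X) <= enorm X.
Proof.
move=> QQ; rewrite -(ler_pXn2r (n := 2)) ?nnegrE ?enorm_ge0 //.
by rewrite (pythagoras X QQ) lerDl sqr_ge0.
Qed.

Lemma bessel_r m n o (X : 'M[R]_(m, o)) (Q : 'M[R]_(o, n)) :
  Q^T *m Q = 1%:M -> enorm (X *m Q) <= enorm X.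
Proof.
move=> QQ; rewrite -enorm_trmx trmx_mul -(enorm_trmx X); exact: bessel.
Qed.

Lemma enorm_ortho m n (Q : 'M[R]_(m, n)) :
  Q^T *m Q = 1%:M -> enorm Q ^+ 2 = n%:R.
Proof. by move=> QQ; rewrite enorm_sqr_tr QQ mxtrace1. Qed.

Lemma enorm_col_le m n (X : 'M[R]_(m, n)) j : enorm (col j X) <= enorm X.
Proof.
rewrite -(ler_pXn2r (n := 2)) ?nnegrE ?enorm_ge0 // (enorm_cols X).
rewrite (bigD1 j) //= lerDl; apply: sumr_ge0 => i _; exact: sqr_ge0.
Qed.

Lemma enorm_mul_diag m n (X : 'M[R]_(m, n)) (d : 'rV[R]_n) (c : R) :
  0 <= c -> (forall j, `|d 0 j| <= c) -> enorm (X *m diag_mx d) <= c * enorm X.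
Proof.
move=> c0 dc; rewrite -(ler_pXn2r (n := 2)) ?nnegrE ?mulr_ge0 ?enorm_ge0 //.
rewrite exprMn !enorm_sqr mulr_sumr; apply: ler_sum => i _.
rewrite mulr_sumr; apply: ler_sum => j _.
rewrite mul_mx_diag mxE exprMn mulrC ler_wpM2r ?sqr_ge0 //.
by rewrite -(real_normK (num_real (d 0 j))) ler_pXn2r ?nnegrE.
Qed.

Lemma enorm_mul_bounded m n o (E : 'M[R]_(m, n)) (X : 'M[R]_(n, o)) (c : R) :
  0 <= c -> (forall x : 'cV[R]_n, enorm (E *m x) <= c * enorm x) ->
  enorm (E *m X) <= c * enorm X.
Proof.
move=> c0 Ec; rewrite -(ler_pXn2r (n := 2)) ?nnegrE ?mulr_ge0 ?enorm_ge0 //.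
rewrite exprMn (enorm_cols (E *m X)) (enorm_cols X) mulr_sumr; apply: ler_sum => j _.
rewrite -exprMn ler_pXn2r ?nnegrE ?mulr_ge0 ?enorm_ge0 //.
by rewrite colE -mulmxA -colE.
Qed.

Lemma enorm_le_cols m n (X : 'M[R]_(m, n)) (c : R) :
  0 <= c -> (forall j, enorm (col j X) <= c) ->
  enorm X <= Num.sqrt n%:R * c.
Proof.
move=> c0 Xc; rewrite -(ler_pXn2r (n := 2)) ?nnegrE ?mulr_ge0 ?enorm_ge0 ?sqrtr_ge0 //.
rewrite enorm_cols exprMn sqr_sqrtr //.
apply: (@le_trans _ _ (\sum_(j < n) c ^+ 2)); last by rewrite sumr_const card_ord mulr_natl.
by apply: ler_sum => j _; rewrite ler_pXn2r ?nnegrE ?enorm_ge0.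
Qed.

Lemma opnorm_bound m n (M : 'M[R]_(m, n)) (x : 'cV[R]_n) :
  enorm (M *m x) <= opnorm M * enorm x.
Proof.
have [x0|xN0] := eqVneq (enorm x) 0.
  by rewrite (enorm_eq0 x0) mulmx0 !enorm0 mulr0.
have xp : 0 < enorm x by rewrite lt0r xN0 enorm_ge0.
rewrite -ler_pdivrMr // mulrC.
have -> : (enorm x)^-1 * enorm (M *m x) = enorm (M *m ((enorm x)^-1 *: x)).
  by rewrite -scalemxAr enormZ ger0_norm // invr_ge0 ltW.
apply: ub_le_sup.
  (* [sup] is informative only on a bounded set; the Frobenius norm is an upper bound. *)
  exists (enorm M) => _ [y /= y1 <-].
  by apply: le_trans (enorm_mulmx _ _) _; rewrite ler_piMr ?enorm_ge0.
exists ((enorm x)^-1 *: x) => //=.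
by rewrite enormZ ger0_norm ?invr_ge0 ?(ltW xp) // mulVf.
Qed.

(** The dimension count behind the two Courant-Fischer arguments below. *)
Lemma exists_kernel m n (C : 'M[R]_(m, n)) :
  (m < n)%N -> exists2 x : 'cV[R]_n, x != 0 & C *m x = 0.
Proof.
move=> mn; have : kermx C^T != 0.
  rewrite -mxrank_eq0 mxrank_ker subn_eq0 -ltnNge.
  exact: leq_ltn_trans (rank_leq_col _) mn.
case/rowV0Pn => v /sub_kermxP vC v0; exists v^T.
  by rewrite trmx_eq0.
by rewrite -[C]trmxK -trmx_mul vC trmx0.
Qed.

(** Rows outside [S] are zeroed rather than removed, so that restrictions to different sets keep one
    shape and can be added. *)
Definition restr m n (S : {set 'I_m}) (X : 'M[R]_(m, n)) : 'M[R]_(m, n) :=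
  \matrix_(i, j) if i \in S then X i j else 0.

Lemma restrD m n (S : {set 'I_m}) (X Y : 'M[R]_(m, n)) :
  restr S (X + Y) = restr S X + restr S Y.
Proof. by apply/matrixP => i j; rewrite !mxE; case: ifP; rewrite ?addr0. Qed.

Lemma restrB m n (S : {set 'I_m}) (X Y : 'M[R]_(m, n)) :
  restr S (X - Y) = restr S X - restr S Y.
Proof. by apply/matrixP => i j; rewrite !mxE; case: ifP; rewrite ?subr0. Qed.

Lemma restr_mul m n o (S : {set 'I_m}) (X : 'M[R]_(m, n)) (Y : 'M[R]_(n, o)) :
  restr S (X *m Y) = restr S X *m Y.
Proof.
apply/matrixP => i j; rewrite !mxE; case: ifP => iS.
  by apply: eq_bigr => l _; rewrite mxE iS.
by rewrite big1 // => l _; rewrite mxE iS mul0r.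
Qed.

Lemma enorm_restr m n (S : {set 'I_m}) (X : 'M[R]_(m, n)) :
  enorm (restr S X) ^+ 2 = \sum_(i in S) enorm (row i X) ^+ 2.
Proof.
rewrite enorm_rows (big_mkcond (fun i => i \in S)); apply: eq_bigr => i _.
rewrite !enorm_sqr; case: ifP => iS.
  by rewrite !big_ord1; apply: eq_bigr => j _; rewrite !mxE iS.
by rewrite big_ord1 big1 // => j _; rewrite !mxE iS expr0n.
Qed.

Lemma enorm_restr_le m n (S : {set 'I_m}) (X : 'M[R]_(m, n)) :
  enorm (restr S X) <= enorm X.
Proof.
rewrite -(ler_pXn2r (n := 2)) ?nnegrE ?enorm_ge0 // enorm_restr enorm_rows.
rewrite big_mkcond; apply: ler_sum => i _; case: ifP => // _; exact: sqr_ge0.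
Qed.

Lemma enorm_col_restr m n (S : {set 'I_m}) (X : 'M[R]_(m, n)) j :
  enorm (restr S (col j X)) <= enorm (restr S X).
Proof.
apply: le_trans (enorm_col_le _ j); rewrite le_eqVlt; apply/orP; left.
by apply/eqP; congr enorm; apply/matrixP => a b; rewrite !mxE.
Qed.

Lemma enorm_row_restr_le m n (S : {set 'I_m}) (X Y : 'M[R]_(m, n)) (c : R) :
  0 <= c -> (forall i, i \in S -> enorm (row i X) <= c * enorm (row i Y)) ->
  enorm (restr S X) <= c * enorm (restr S Y).
Proof.
move=> c0 XY; rewrite -(ler_pXn2r (n := 2)) ?nnegrE ?mulr_ge0 ?enorm_ge0 //.
rewrite exprMn !enorm_restr mulr_sumr; apply: ler_sum => i iS.
by rewrite -exprMn ler_pXn2r ?nnegrE ?mulr_ge0 ?enorm_ge0 // XY.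
Qed.

End Frobenius.

(** * Spectrum of a noisy block matrix *)

Section BlockSpectrum.
Context {R : realType} (n k : nat) (z : 'I_n -> 'I_k) (p q nmin sigma : R).
Hypotheses (q0 : 0 < q) (qp : q < p) (nmin0 : 0 < nmin).
Hypothesis nminP : forall a, nmin <= (comm_size z a)%:R.

(* The mean adjacency matrix with its diagonal filled in by [p], so that its
   rows are constant on communities. *)
Definition block_mx_mean : 'M[R]_n :=
  \matrix_(i, j) if z i == z j then p else q.

Local Notation N0 := block_mx_mean.

Definition membership : 'M[R]_(n, k) := \matrix_(i, a) (z i == a)%:R.

Local Notation Z := membership.

(** Both summands are positive semidefinite since [0 < q < p], and both vanish on vectors orthogonal
    to the columns of [Z]; these facts give the lower and the upper eigenvalue bounds. *)
Lemma block_mx_meanE :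
  N0 = q *: (const_mx 1 *m (const_mx 1 : 'cV_n)^T) + (p - q) *: (Z *m Z^T).
Proof.
apply/matrixP => i j; rewrite !mxE big_ord1 !mxE.
have -> : \sum_a Z i a * Z^T a j = (z i == z j)%:R.
  rewrite (bigD1 (z i)) //= !mxE eqxx mul1r big1 ?addr0 => [|a az].
    by rewrite eq_sym.
  by rewrite !mxE eq_sym (negbTE az) mul0r.
by case: eqP => _ /=; ring.
Qed.

Lemma block_mx_mean_quad (x : 'cV[R]_n) :
  \tr (x^T *m (N0 *m x)) =
  q * enorm ((const_mx 1 : 'cV[R]_n)^T *m x) ^+ 2 +
  (p - q) * enorm (Z^T *m x) ^+ 2.
Proof.
rewrite block_mx_meanE mulmxDl mulmxDr mxtraceD -!scalemxAl -!scalemxAr.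
by rewrite !mxtraceZ !enorm_sqr_tr !trmx_mul !trmxK !mulmxA.
Qed.

Lemma membership_gram : Z^T *m Z = diag_mx (\row_a (comm_size z a)%:R).
Proof.
apply/matrixP => a b; rewrite !mxE.
under eq_bigr do rewrite !mxE -natrM mulnb.
rewrite -natr_sum; have [<-|ab] := eqVneq a b.
  rewrite mulr1n /comm_size -sum1_card [in RHS]big_mkcond /=; congr (_%:R).
  by apply: eq_bigr => i _; rewrite andbb inE; case: eqP.
rewrite mulr0n big1 // => i _; case: eqP => // ->.
by rewrite (negbTE ab).
Qed.

Lemma enorm_membership (y : 'cV[R]_k) :
  enorm (Z *m y) ^+ 2 = \sum_a (comm_size z a)%:R * y a 0 ^+ 2.
Proof.
rewrite enorm_sqr_tr trmx_mul -mulmxA (mulmxA Z^T) membership_gram.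
rewrite /mxtrace big_ord1 mxE; apply: eq_bigr => a _.
by rewrite mul_diag_mx !mxE; ring.
Qed.

Lemma enorm_membership_gram (y : 'cV[R]_k) :
  nmin * enorm (Z *m y) ^+ 2 <= enorm (Z^T *m (Z *m y)) ^+ 2.
Proof.
rewrite enorm_membership mulmxA membership_gram enorm_sqr mulr_sumr.
apply: ler_sum => a _; rewrite big_ord1 mul_diag_mx !mxE exprMn mulrA.
by rewrite ler_wpM2r ?sqr_ge0 // expr2 ler_wpM2r.
Qed.

Lemma membership_inj (y : 'cV[R]_k) : y != 0 -> Z *m y != 0.
Proof.
apply: contra_neq => Zy; apply/matrixP => a b; rewrite ord1 mxE.
have := enorm_membership y; rewrite Zy enorm0 expr0n /= => /esym/eqP.
rewrite psumr_eq0 => [|c _]; last by rewrite mulr_ge0 ?sqr_ge0.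
move=> /allP/(_ a (mem_index_enum _)) /=; rewrite mulf_eq0 sqrf_eq0.
case/orP => /eqP // E; move: (nminP a); rewrite E => /(lt_le_trans nmin0).
by rewrite ltxx.
Qed.

Variables (E M : 'M[R]_n).
Hypothesis ME : M = N0 + E.
Hypothesis sigma0 : 0 <= sigma.
Hypothesis E_le : forall x : 'cV[R]_n, enorm (E *m x) <= sigma * enorm x.

Lemma quad_noise (x : 'cV[R]_n) :
  `|\tr (x^T *m (E *m x))| <= sigma * enorm x ^+ 2.
Proof.
apply: le_trans (inner_le _ _) _; rewrite expr2 mulrCA.
by rewrite ler_wpM2l ?enorm_ge0.
Qed.

Lemma quadD (x : 'cV[R]_n) :
  \tr (x^T *m (M *m x)) = \tr (x^T *m (N0 *m x)) + \tr (x^T *m (E *m x)).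
Proof. by rewrite ME mulmxDl mulmxDr mxtraceD. Qed.

Variables (V : 'M[R]_n) (lam : 'I_n -> R).
Hypothesis VV : V^T *m V = 1%:M.
Hypothesis MV : M = \sum_(i < n) lam i *: (col i V *m (col i V)^T).
Hypothesis lam_sorted : forall i j : 'I_n, (i <= j)%N -> lam j <= lam i.

Lemma quad_eigen (x : 'cV[R]_n) :
  \tr (x^T *m (M *m x)) = \sum_l lam l * (V^T *m x) l 0 ^+ 2.
Proof.
rewrite MV mulmx_suml mulmx_sumr raddf_sum /=; apply: eq_bigr => l _.
rewrite -scalemxAl -scalemxAr mxtraceZ; congr (_ * _).
have -> : x^T *m (col l V *m (col l V)^T *m x) =
    ((col l V)^T *m x)^T *m ((col l V)^T *m x).
  by rewrite trmx_mul trmxK !mulmxA.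
rewrite -enorm_sqr_tr enorm_sqr !big_ord1; congr (_ ^+ 2).
by rewrite !mxE; apply: eq_bigr => i _; rewrite !mxE.
Qed.

Lemma enorm_eigen (x : 'cV[R]_n) : enorm x ^+ 2 = \sum_l (V^T *m x) l 0 ^+ 2.
Proof.
have VVT : (V^T)^T *m V^T = 1%:M by rewrite trmxK; exact: mulmx1C.
rewrite -(enorm_ortho_mul x VVT) enorm_sqr.
by apply: eq_bigr => l _; rewrite big_ord1.
Qed.

(** Courant-Fischer: the range of [Z] has dimension [k > l], hence contains a nonzero [x] orthogonal
    to the first [l] eigenvectors. There the form of [M] is at most [lam l * enorm x ^+ 2], while
    its block part is at least [(p - q) * nmin * enorm x ^+ 2]. *)
Lemma top_eigenvalue_ge (l : 'I_n) :
  (l < k)%N -> (p - q) * nmin - sigma <= lam l.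
Proof.
move=> lk.
pose C : 'M[R]_(l, k) :=
  (colsub (widen_ord (ltnW (ltn_ord l))) V)^T *m Z.
have [y yN0 Cy] := exists_kernel C lk.
set x : 'cV[R]_n := Z *m y.
have x0 : 0 < enorm x.
  rewrite lt0r enorm_ge0 andbT; apply: contra_neq (membership_inj yN0).
  exact: enorm_eq0.
have Vx (m : 'I_n) : (m < l)%N -> (V^T *m x) m 0 = 0.
  move=> ml; have := congr1 (fun X : 'cV[R]_l => X (Ordinal ml) 0) Cy.
  rewrite /C -mulmxA -/x !mxE => E0; rewrite -[RHS]E0.
  apply: eq_bigr => i _; rewrite !mxE; congr (V i _ * _); exact: val_inj.
have up : \tr (x^T *m (M *m x)) <= lam l * enorm x ^+ 2.
  rewrite quad_eigen enorm_eigen mulr_sumr; apply: ler_sum => m _.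
  have [ml|lm] := ltnP m l; first by rewrite Vx // expr0n !mulr0.
  by rewrite ler_wpM2r ?sqr_ge0 // lam_sorted.
have lo : ((p - q) * nmin - sigma) * enorm x ^+ 2 <= \tr (x^T *m (M *m x)).
  rewrite quadD block_mx_mean_quad.
  have /ler_normlP[+ _] := quad_noise x.
  have := enorm_membership_gram y; rewrite -/x => gram.
  have pq : 0 <= p - q by rewrite subr_ge0 ltW.
  have := ler_wpM2l pq gram.
  have : 0 <= q * enorm ((const_mx 1 : 'cV[R]_n)^T *m x) ^+ 2.
    by rewrite mulr_ge0 ?sqr_ge0 // ltW.
  set e := enorm x ^+ 2; set e1 := enorm (_ *m x) ^+ 2.
  set e2 := enorm (Z^T *m x) ^+ 2; set e3 := \tr _; move=> *; lra.
by have := le_trans lo up; rewrite ler_pM2r // exprn_gt0.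
Qed.

(** The dual count: the span of the first [l.+1 > k] eigenvectors contains a nonzero [x] orthogonal
    to the columns of [Z], where the form of [M] reduces to the noise. *)
Lemma low_eigenvalue_le (l : 'I_n) : (k <= l)%N -> lam l <= sigma.
Proof.
move=> kl.
pose Vs : 'M[R]_(n, l.+1) := colsub (widen_ord (ltn_ord l)) V.
have VsVs : Vs^T *m Vs = 1%:M.
  apply/matrixP => a b.
  have := congr1 (fun X : 'M[R]_n =>
    X (widen_ord (ltn_ord l) a) (widen_ord (ltn_ord l) b)) VV.
  rewrite !mxE -val_eqE /= => <-.
  by apply: eq_bigr => i _; rewrite !mxE.
have [y yN0 Cy] := exists_kernel (Z^T *m Vs) (kl : (k < l.+1)%N).
set x : 'cV[R]_n := Vs *m y.
have nx : enorm x = enorm y by rewrite enorm_ortho_mul.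
have x0 : 0 < enorm x.
  rewrite nx lt0r enorm_ge0 andbT; apply: contra_neq yN0; exact: enorm_eq0.
have lo : lam l * enorm x ^+ 2 <= \tr (x^T *m (M *m x)).
  rewrite quad_eigen enorm_eigen mulr_sumr; apply: ler_sum => m _.
  have [ml|lm] := leqP m l; first by rewrite ler_wpM2r ?sqr_ge0 // lam_sorted.
  suff -> : (V^T *m x) m 0 = 0 by rewrite expr0n !mulr0.
  rewrite /x mulmxA mxE big1 // => a _.
  suff -> : (V^T *m Vs) m a = 0 by rewrite mul0r.
  have := congr1 (fun X : 'M[R]_n => X m (widen_ord (ltn_ord l) a)) VV.
  rewrite !mxE (_ : (m == _) = false) => [E0|].
    by rewrite -[RHS]E0; apply: eq_bigr => i _; rewrite !mxE.
  by apply/negbTE; rewrite -val_eqE /= gtn_eqF // (leq_trans (ltn_ord a)).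
have up : \tr (x^T *m (M *m x)) <= sigma * enorm x ^+ 2.
  have Zx : Z^T *m x = 0 by rewrite mulmxA.
  have Ox : (const_mx 1 : 'cV[R]_n)^T *m x = 0.
    (* The columns of [Z] sum to the all-ones vector. *)
    have -> : (const_mx 1 : 'cV[R]_n)^T = (const_mx 1 : 'cV[R]_k)^T *m Z^T.
      apply/matrixP => i j; rewrite !mxE (bigD1 (z j)) //= !mxE eqxx mulr1.
      by rewrite big1 ?addr0 // => a az; rewrite !mxE eq_sym (negbTE az) mulr0.
    by rewrite -mulmxA Zx mulmx0.
  rewrite quadD block_mx_mean_quad Zx Ox !enorm0 expr0n /= !mulr0 !add0r.
  exact: le_trans (ler_norm _) (quad_noise x).
by have := le_trans lo up; rewrite ler_pM2r // exprn_gt0.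
Qed.

End BlockSpectrum.

(** A spectral gap between the span of [U] and its complement, stated through the quadratic form so
    that the eigenvectors beyond the [k]-th can be forgotten. *)
Definition spectral_split {R : realType} n k (M : 'M[R]_n) (U : 'M[R]_(n, k))
    (lam : 'rV[R]_k) (lo hi : R) : Prop :=
  [/\ U^T *m U = 1%:M, M *m U = U *m diag_mx lam,
      (forall r : 'cV[R]_n, U^T *m r = 0 ->
         \tr (r^T *m (M *m r)) <= hi * enorm r ^+ 2)
    & forall j, lo <= lam 0 j].

Lemma leading_spectral_split {R : realType} n k (z : 'I_n -> 'I_k)
    (p q nmin sigma : R) (E M : 'M[R]_n) (U : 'M[R]_(n, k)) :
  0 < q -> q < p -> 0 < nmin -> (forall a, nmin <= (comm_size z a)%:R) ->
  (k <= n)%N -> M = block_mx_mean z p q + E -> 0 <= sigma ->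
  (forall x : 'cV[R]_n, enorm (E *m x) <= sigma * enorm x) ->
  leading_eigenvectors M U ->
  exists lam, spectral_split M U lam ((p - q) * nmin - sigma) sigma.
Proof.
move=> q0 qp nmin0 nminP kn ME s0 E_le [V [lam [VV MV lam_sorted UV]]].
(* Since [k <= n], every column of [U] is a column of [V]. *)
pose w := widen_ord kn.
have Uw : U = colsub w V.
  apply/matrixP => i j; have := UV j (w j) erefl.
  by move/(congr1 (fun X : 'cV[R]_n => X i 0)); rewrite !mxE.
have MVl l : M *m col l V = lam l *: col l V.
  rewrite {1}MV mulmx_suml (bigD1 l) //= big1 ?addr0.
    rewrite -scalemxAl -mulmxA (_ : _ *m col l V = 1%:M) ?mulmx1 //.
    apply/matrixP => a b; rewrite !ord1.
    have := congr1 (fun X : 'M[R]_n => X l l) VV; rewrite !mxE !eqxx => <-.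
    by apply: eq_bigr => i _; rewrite !mxE.
  move=> m ml; rewrite -scalemxAl -mulmxA (_ : _ *m col l V = 0) ?mulmx0 ?scaler0 //.
  apply/matrixP => a b; rewrite !ord1.
  have := congr1 (fun X : 'M[R]_n => X m l) VV; rewrite !mxE (negbTE ml) => E0.
  by rewrite -[RHS]E0; apply: eq_bigr => i _; rewrite !mxE.
exists (\row_j lam (w j)); split.
- apply/matrixP => a b.
  have := congr1 (fun X : 'M[R]_n => X (w a) (w b)) VV.
  rewrite !mxE -val_eqE /= => <-.
  by apply: eq_bigr => i _; rewrite Uw !mxE.
- apply/matrixP => i j.
  have := congr1 (fun X : 'cV[R]_n => X i 0) (MVl (w j)).
  rewrite mul_mx_diag !mxE Uw mxE mulrC => <-.
  by apply: eq_bigr => l _; rewrite !mxE.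
- move=> r Ur; rewrite (quad_eigen MV) (enorm_eigen VV r) mulr_sumr.
  apply: ler_sum => l _; have [kl|lk] := leqP k l.
    rewrite ler_wpM2r ?sqr_ge0 //.
    exact: (low_eigenvalue_le ME E_le VV MV lam_sorted).
  suff -> : (V^T *m r) l 0 = 0 by rewrite expr0n !mulr0.
  have := congr1 (fun X : 'cV[R]_k => X (Ordinal lk) 0) Ur.
  rewrite !mxE => E0; rewrite -[RHS]E0; apply: eq_bigr => i _.
  by rewrite Uw !mxE; congr (V i _ * _); exact: val_inj.
- move=> j; rewrite mxE.
  by apply: (top_eigenvalue_ge q0 qp nmin0 nminP ME E_le VV MV lam_sorted) => /=.
Qed.

(** * Comparison of eigenspaces *)

Section Signal.
Context {R : realType} (n k : nat) (N0 E M : 'M[R]_n) (U : 'M[R]_(n, k)).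
Context (lam : 'rV[R]_k) (lo hi sigma : R).
Hypotheses (split : spectral_split M U lam lo hi) (lo0 : 0 < lo).
Hypotheses (ME : M = N0 + E) (sigma0 : 0 <= sigma).
Hypothesis E_le : forall x : 'cV[R]_n, enorm (E *m x) <= sigma * enorm x.

(* The eigenvector equation reads [U = signal + E U diag(lam)^-1]. *)
Definition signal_mx (N0' : 'M[R]_n) (U' : 'M[R]_(n, k)) (lam' : 'rV[R]_k) :=
  N0' *m U' *m diag_mx (map_mx (fun x => x^-1) lam').

Local Notation G := (signal_mx N0 U lam).

Let lam_gt0 j : 0 < lam 0 j.
Proof. by case: split => _ _ _ lamP; apply: lt_le_trans (lamP j). Qed.

Lemma residualE : U - G = E *m U *m diag_mx (map_mx (fun x => x^-1) lam).
Proof.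
case: split => _ MU _ _.
have UE : U = M *m U *m diag_mx (map_mx (fun x => x^-1) lam).
  rewrite MU; apply/matrixP => i j; rewrite !mul_mx_diag !mxE.
  by rewrite mulfK // gt_eqF.
by rewrite {1}UE /signal_mx ME !mulmxDl addrC addKr.
Qed.

Lemma noise_mulE : E *m U = (U - G) *m diag_mx lam.
Proof.
rewrite residualE; apply/matrixP => i j; rewrite !mul_mx_diag !mxE.
by rewrite mulfVK // gt_eqF.
Qed.

Lemma diag_inv_le j : `|(map_mx (fun x => x^-1) lam) 0 j| <= lo^-1.
Proof.
rewrite mxE ger0_norm ?invr_ge0 ?(ltW (lam_gt0 j)) // lef_pV2 ?posrE //.
by case: split => _ _ _; apply.
Qed.

Lemma enorm_residual : enorm (U - G) <= sigma / lo * Num.sqrt k%:R.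
Proof.
have [UU _ _ _] := split.
have Uk : enorm U = Num.sqrt k%:R.
  by rewrite -(enorm_ortho UU) sqrtr_sqr ger0_norm ?enorm_ge0.
rewrite residualE; apply: le_trans (enorm_mul_diag _ _ diag_inv_le) _.
  by rewrite invr_ge0 ltW.
rewrite mulrC -Uk -mulrA [lo^-1 * _]mulrC mulrA ler_wpM2r ?invr_ge0 ?(ltW lo0) //.
exact: enorm_mul_bounded.
Qed.

End Signal.

Lemma enorm_col_mul_diag {R : realType} m n (X : 'M[R]_(m, n)) d j :
  col j (X *m diag_mx d) = d 0 j *: col j X.
Proof. by apply/matrixP => a b; rewrite mul_mx_diag !mxE mulrC. Qed.

Section Comparison.
Context {R : realType} (n k : nat) (N0 E M E' M' : 'M[R]_n).
Context (U Q : 'M[R]_(n, k)) (lam lam' : 'rV[R]_k) (lo sigma : R).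
Context (S J : {set 'I_n}).
Hypotheses (split : spectral_split M U lam lo sigma).
Hypotheses (split' : spectral_split M' Q lam' lo sigma) (M'T : M'^T = M').
Hypotheses (ME : M = N0 + E) (ME' : M' = N0 + E').
Hypotheses (lo0 : 0 < lo) (sigma0 : 0 <= sigma).
Hypothesis sigma_lo : sigma * k%:R <= lo / 500.
Hypothesis E_le : forall x : 'cV[R]_n, enorm (E *m x) <= sigma * enorm x.
Hypothesis E'_le : forall x : 'cV[R]_n, enorm (E' *m x) <= sigma * enorm x.
Hypothesis agree : forall i j, i \notin S -> j \notin S -> M i j = M' i j.
Hypothesis signal_small : forall i, i \in S ->
  enorm (row i (signal_mx N0 U lam)) <= 1 / 100 * enorm (row i U).
Hypothesis signal_small' : forall i, i \in S ->
  enorm (row i (signal_mx N0 Q lam')) <= 1 / 100 * enorm (row i Q).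
Hypothesis Q_le : enorm (restr S Q) <= 2 * enorm (restr S U).

Local Notation G := (signal_mx N0 U lam).
Local Notation G' := (signal_mx N0 Q lam').
Local Notation a := (enorm (restr S U)).

Lemma restr_residual_le : enorm (restr S (U - G)) <= 101 / 100 * a.
Proof.
rewrite restrB; apply: le_trans (enormB _ _) _.
have : enorm (restr S G) <= 1 / 100 * a.
  by apply: enorm_row_restr_le => //; lra.
lra.
Qed.

Lemma restr_residual_le' : enorm (restr S (Q - G')) <= 202 / 100 * a.
Proof.
rewrite restrB; apply: le_trans (enormB _ _) _.
have : enorm (restr S G') <= 1 / 100 * enorm (restr S Q).
  by apply: enorm_row_restr_le => //; lra.
move: Q_le; lra.
Qed.

Lemma diff_noise : M - M' = E - E'.
Proof. by rewrite ME ME' opprD addrACA subrr add0r. Qed.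

(** [M] and [M'] differ only in entries that touch [S], so outside [S] the difference reads only the
    coordinates of [x] in [S]. *)
Lemma diff_restrC (x : 'cV[R]_n) :
  restr (~: S) ((M - M') *m x) = restr (~: S) ((M - M') *m restr S x).
Proof.
apply/matrixP => i j; rewrite !mxE inE; case: ifP => // /negP/negP iS.
apply: eq_bigr => l _; rewrite [restr _ _ _ _]mxE.
by case: ifPn => // lS; rewrite !mxE agree // subrr !mul0r.
Qed.

Lemma restr_split m (X : 'M[R]_(n, m)) : X = restr S X + restr (~: S) X.
Proof.
by apply/matrixP => i j; rewrite !mxE inE; case: ifP; rewrite ?addr0 ?add0r.
Qed.

(** Davis-Kahan with a localized perturbation: the component [r] of [u] orthogonal to [Q] satisfies
    [(mu - sigma) * enorm r <= enorm ((M - M') *m u)], and the right-hand side is [O(mu * a)] up to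
    [sigma * enorm r]. Outside [S] it sees only [restr S u]; on [S] the eigenvector equations of [M]
    and [M'] express the noise through small residuals. *)
Lemma projection_error (j : 'I_k) :
  enorm (col j U - Q *m (Q^T *m col j U)) <= 4 * a.
Proof.
have [UU MU _ lamP] := split; have [QQ MQ low' _] := split'.
set u := col j U; set y := Q^T *m u; set r := u - Q *m y.
set mu := lam 0 j.
have lo_mu : lo <= mu by exact: lamP.
have mu0 : 0 < mu := lt_le_trans lo0 lo_mu.
have mu0' := ltW mu0.
have k1 : 1 <= k%:R :> R by rewrite ler1n (leq_ltn_trans _ (ltn_ord j)).
have sigma_mu : sigma <= mu / 500.
  have : sigma <= sigma * k%:R by rewrite ler_peMr.
  move: sigma_lo lo_mu; lra.
have a0 := enorm_ge0 (restr S U); have r0 := enorm_ge0 r.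
have nu : enorm u = 1.
  apply/eqP; rewrite -(eqrXn2 (n := 2)) ?enorm_ge0 // expr1n enorm_sqr_tr.
  have -> : u^T *m u = 1%:M.
    apply/matrixP => b c; rewrite !ord1.
    have := congr1 (fun X : 'M[R]_k => X j j) UU; rewrite !mxE !eqxx => <-.
    by apply: eq_bigr => i _; rewrite !mxE.
  by rewrite mxtrace1.
have ua : enorm (restr S u) <= a by exact: enorm_col_restr.
have Mu : M *m u = mu *: u.
  by rewrite -enorm_col_mul_diag -MU /u !colE mulmxA.
have Qr : Q^T *m r = 0 by rewrite /r mulmxBr mulmxA QQ mul1mx subrr.
have uE : u = Q *m y + r by rewrite /r addrC subrK.
clearbody r.
have rQ : r^T *m Q = 0 by rewrite -[Q]trmxK -trmx_mul Qr trmx0.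
have Eu : restr S (E *m u) = mu *: restr S (col j (U - G)).
  rewrite /u colE mulmxA (noise_mulE split lo0 ME) -colE enorm_col_mul_diag.
  by apply/matrixP => b c; rewrite !mxE; case: ifP; rewrite ?mulr0.
have Du : (M - M') *m u = E *m u - E' *m u by rewrite diff_noise mulmxBl.
have nDu : enorm ((M - M') *m u) <= 2 * sigma.
  rewrite Du; apply: le_trans (enormB _ _) _.
  move: (E_le u) (E'_le u); rewrite nu; lra.
have ny : enorm y <= 1 by rewrite -nu; exact: bessel.
(* [lam'] is bounded only from below, so [diag_mx lam' *m y] is rewritten as [Q^T *m (M' *m u)] and
   compared with [mu *: y]. *)
have Ly : enorm (diag_mx lam' *m y) <= mu + 2 * sigma.
  have -> : diag_mx lam' *m y = mu *: y - Q^T *m ((M - M') *m u).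
    rewrite mulmxBl Mu mulmxBr -scalemxAr opprB addrC subrK mulmxA.
    have -> : Q^T *m M' = diag_mx lam' *m Q^T.
      by rewrite -{1}M'T -trmx_mul MQ trmx_mul tr_diag_mx.
    by rewrite mulmxA.
  apply: le_trans (enormB _ _) _; rewrite enormZ ger0_norm //.
  apply: lerD; last by apply: le_trans (bessel _ QQ) _.
  by rewrite ler_piMr.
have E'u : enorm (restr S (E' *m u)) <=
    202 / 100 * a * (mu + 2 * sigma) + sigma * enorm r.
  rewrite [in E' *m u]uE mulmxDr restrD; apply: le_trans (enormD _ _) _.
  apply: lerD; last by apply: le_trans (enorm_restr_le _ _) _.
  rewrite mulmxA (noise_mulE split' lo0 ME') -mulmxA restr_mul.
  apply: le_trans (enorm_mulmx _ _) _.
  by apply: ler_pM; rewrite ?enorm_ge0 // restr_residual_le'.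
have Dle : enorm ((M - M') *m u) <= 2 * sigma * a + mu * (101 / 100 * a) +
    (202 / 100 * a * (mu + 2 * sigma) + sigma * enorm r).
  rewrite [X in enorm X](restr_split ((M - M') *m u)).
  apply: le_trans (enormD _ _) _; rewrite addrC -addrA; apply: lerD.
    rewrite diff_restrC; apply: le_trans (enorm_restr_le _ _) _.
    rewrite diff_noise mulmxBl; apply: le_trans (enormB _ _) _.
    have := E_le (restr S u); have := E'_le (restr S u).
    have := ler_wpM2l sigma0 ua; lra.
  rewrite Du restrB; apply: le_trans (enormB _ _) _; apply: lerD => //.
  rewrite Eu enormZ ger0_norm // ler_wpM2l //.
  exact: le_trans (enorm_col_restr _ _ _) restr_residual_le.
(* The span of [Q] is invariant under [M'] and [r] is orthogonal to it, so testing [M' *m u] against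
   [r] amounts to testing [M' *m r]. *)
have quad : mu * enorm r ^+ 2 - \tr (r^T *m (M' *m r)) =
    \tr (r^T *m ((M - M') *m u)).
  have ru : r^T *m u = r^T *m r.
    have -> : r^T *m u = r^T *m (Q *m y) + r^T *m r by rewrite -mulmxDr -uE.
    by rewrite (mulmxA _ Q) rQ mul0mx add0r.
  have rM' : r^T *m (M' *m u) = r^T *m (M' *m r).
    have -> : r^T *m (M' *m u) = r^T *m (M' *m (Q *m y)) + r^T *m (M' *m r).
      by rewrite -!mulmxDr -uE.
    by rewrite (mulmxA M' Q) MQ -(mulmxA Q) (mulmxA _ Q) rQ mul0mx add0r.
  have DuE : (M - M') *m u = mu *: u - M' *m u by rewrite mulmxBl Mu.
  have -> : r^T *m ((M - M') *m u) = mu *: (r^T *m r) - r^T *m (M' *m r).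
    by rewrite DuE mulmxBr rM' -scalemxAr ru.
  by rewrite mxtraceD mxtraceZ enorm_sqr_tr [\tr (- _)]raddfN.
have gap : (mu - sigma) * enorm r <= enorm ((M - M') *m u).
  have [r_eq0|rN0] := eqVneq (enorm r) 0; first by rewrite r_eq0 mulr0 enorm_ge0.
  have rp : 0 < enorm r by rewrite lt0r rN0.
  rewrite -(ler_pM2r rp); have := le_trans (ler_norm _) (inner_le r ((M - M') *m u)).
  rewrite -quad; have := low' r Qr; rewrite expr2; lra.
have main : (mu - sigma) * enorm r <= 2 * sigma * a + mu * (101 / 100 * a) +
    (202 / 100 * a * (mu + 2 * sigma) + sigma * enorm r) := le_trans gap Dle.
rewrite -(ler_pM2l mu0).
have := ler_wpM2r a0 sigma_mu; have := ler_wpM2r r0 sigma_mu.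
have : 0 <= mu * a by rewrite mulr_ge0 // ltW.
lra.
Qed.

Hypothesis U_supp : U = restr S U + restr J U.

(** On [S] the residual has norm at least [99 / 100 * a]. Split [U] into its part on [S], the
    projection onto [Q] restricted to [J], and the remainder [rm] on [J]: the first and the last
    contribute [O(sigma * sqrt k * a / lo)], so the middle one must be large. Orthonormality removes
    the factor [Q^T *m U], and [L] costs [lo^-1]. *)
Lemma class_representative_large :
  98 / 100 * lo * a <= enorm (restr S (E *m restr J Q)).
Proof.
have [UU _ _ _] := split; have [QQ _ _ _] := split'.
set X := restr S (E *m _).
set rm := U - Q *m (Q^T *m U).
have a0 := enorm_ge0 (restr S U).
pose L := diag_mx (map_mx (fun x => x^-1) lam).
have lo0' : 0 <= lo^-1 by rewrite invr_ge0 ltW.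
have XE : restr S (U - G) = X *m (Q^T *m U) *m L +
    (restr S (E *m restr J rm) + restr S (E *m restr S U)) *m L.
  rewrite (residualE split lo0 ME) restr_mul -mulmxDl; congr (_ *m _).
  rewrite {1}U_supp mulmxDr restrD addrC addrA; congr (_ + _).
  rewrite /X -restr_mul -mulmxA -restr_mul -restrD -mulmxDr -restrD.
  by rewrite /rm addrC subrK.
have n1 : enorm (X *m (Q^T *m U) *m L) <= lo^-1 * enorm X.
  apply: le_trans (enorm_mul_diag _ lo0' (diag_inv_le split lo0)) _.
  rewrite ler_wpM2l // mulmxA; apply: le_trans (bessel_r _ UU) _.
  by rewrite enorm_mul_ortho.
have sk0 : 0 <= Num.sqrt k%:R :> R by exact: sqrtr_ge0.
have nrm : enorm rm <= Num.sqrt k%:R * (4 * a).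
  apply: enorm_le_cols; first lra.
  move=> j; have -> : col j rm = col j U - Q *m (Q^T *m col j U).
    by rewrite /rm linearB /= !colE !mulmxA.
  exact: projection_error.
have n2 : enorm ((restr S (E *m restr J rm) + restr S (E *m restr S U)) *m L)
    <= lo^-1 * (sigma * (Num.sqrt k%:R * (4 * a)) + sigma * a).
  apply: le_trans (enorm_mul_diag _ lo0' (diag_inv_le split lo0)) _.
  rewrite ler_wpM2l //; apply: le_trans (enormD _ _) _.
  apply: lerD; apply: le_trans (enorm_restr_le _ _) _.
    apply: le_trans (enorm_mul_bounded _ sigma0 E_le) _.
    rewrite ler_wpM2l //; exact: le_trans (enorm_restr_le _ _) nrm.
  exact: enorm_mul_bounded.
(* Without columns everything is [0]; otherwise [1 <= k%:R] absorbs [4 * Num.sqrt k%:R + 1] into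
   [5 * k%:R]. *)
have [k0|kp] := posnP k.
  have -> : a = 0.
    apply/eqP; rewrite -sqrf_eq0 enorm_sqr big1 // => i _.
    rewrite big1 // => j _; have := ltn_ord j; by rewrite {2}k0.
  by rewrite mulr0 enorm_ge0.
have k1 : 1 <= k%:R :> R by rewrite ler1n.
have sk : Num.sqrt k%:R <= k%:R :> R.
  rewrite -[X in _ <= X]ger0_norm // -sqrtr_sqr ler_wsqrtr // expr2.
  by rewrite ler_peMr.
have low : 99 / 100 * a <= enorm (restr S (U - G)).
  have : enorm (restr S G) <= 1 / 100 * a.
    by apply: enorm_row_restr_le => //; lra.
  have := enormD (restr S (U - G)) (restr S G).
  rewrite -restrD subrK; lra.
have := le_trans (enormD _ _) (lerD n1 n2); rewrite -XE => up.
have up' := le_trans low up.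
have : 99 / 100 * a * lo <= enorm X + sigma * a * (4 * Num.sqrt k%:R + 1).
  have := ler_wpM2r (ltW lo0) up'.
  have -> : (lo^-1 * enorm X + lo^-1 *
     (sigma * (Num.sqrt k%:R * (4 * a)) + sigma * a)) * lo =
     enorm X + sigma * a * (4 * Num.sqrt k%:R + 1).
    by field; rewrite gt_eqF.
  by [].
have : sigma * a * (4 * Num.sqrt k%:R + 1) <= 5 * (sigma * k%:R * a).
  have -> : 5 * (sigma * k%:R * a) = sigma * a * (5 * k%:R) by ring.
  by rewrite ler_wpM2l ?mulr_ge0 //; lra.
have := ler_wpM2r a0 sigma_lo.
lra.
Qed.

End Comparison.

(** * Products of Bernoulli variables *)

Section BernoulliProduct.
Context {R : realType} {I : finType} (mu : I -> R).
Hypothesis mu01 : forall e, 0 <= mu e <= 1.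

(** The product law on graphs as a finite weight: moments are computed by finite sums and only later
    identified with expectations under [P]. *)
Definition bern_weight (a : {ffun I -> bool}) : R :=
  \prod_e (if a e then mu e else 1 - mu e).

Definition bern_mean (f : {ffun I -> bool} -> R) : R :=
  \sum_a bern_weight a * f a.

Lemma bern_weight_ge0 a : 0 <= bern_weight a.
Proof.
apply: prodr_ge0 => e _; have /andP[? ?] := mu01 e.
by case: (a e) => //; rewrite subr_ge0.
Qed.

Lemma bern_mean_prod (F : I -> bool -> R) :
  bern_mean (fun a => \prod_e F e (a e)) =
  \prod_e (mu e * F e true + (1 - mu e) * F e false).
Proof.
transitivity (\sum_(a : {ffun I -> bool})
    \prod_e ((if a e then mu e else 1 - mu e) * F e (a e))).
  by apply: eq_bigr => a _; rewrite big_split.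
rewrite -(bigA_distr_bigA (fun e (b : bool) =>
  (if b then mu e else 1 - mu e) * F e b)) /=.
by apply: eq_bigr => e _; rewrite big_bool.
Qed.

Lemma bern_weight_sum : \sum_a bern_weight a = 1.
Proof.
transitivity (bern_mean (fun a => \prod_(e : I) (fun=> 1 : R) (a e))).
  by apply: eq_bigr => a _; rewrite big1 ?mulr1.
rewrite (bern_mean_prod (fun _ _ => 1)) big1 // => e _.
by rewrite !mulr1 subrKC.
Qed.

Lemma bern_mean_le f g :
  (forall a, f a <= g a) -> bern_mean f <= bern_mean g.
Proof.
by move=> fg; apply: ler_sum => a _; rewrite ler_wpM2l ?bern_weight_ge0.
Qed.

Lemma bern_meanZ c f : bern_mean (fun a => c * f a) = c * bern_mean f.
Proof.
by rewrite /bern_mean mulr_sumr; apply: eq_bigr => a _; rewrite mulrCA.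
Qed.

Lemma bern_meanD f g :
  bern_mean (fun a => f a + g a) = bern_mean f + bern_mean g.
Proof. by rewrite /bern_mean -big_split; apply: eq_bigr => a _; rewrite mulrDr. Qed.

Lemma bern_mean_cst c : bern_mean (fun=> c) = c.
Proof. by rewrite /bern_mean -mulr_suml bern_weight_sum mul1r. Qed.

Lemma bern_mean_sum (J : finType) (P : pred J) (f : J -> {ffun I -> bool} -> R) :
  bern_mean (fun a => \sum_(j | P j) f j a) = \sum_(j | P j) bern_mean (f j).
Proof.
rewrite /bern_mean exchange_big /=; apply: eq_bigr => a _.
by rewrite mulr_sumr.
Qed.

(** The mean factorizes over coordinates, and each factor [1 + mu e * (expR (c e) - 1)] is at most
    its exponential. *)
Lemma bern_mean_expR (c : I -> R) :
  bern_mean (fun a => expR (\sum_e c e * (a e)%:R)) <=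
  expR (\sum_e mu e * (expR (c e) - 1)).
Proof.
rewrite (_ : bern_mean _ = bern_mean (fun a => \prod_e expR (c e * (a e)%:R))).
  rewrite (bern_mean_prod (fun e b => expR (c e * b%:R))) expR_sum.
  apply: ler_prod => e _; have /andP[m0 m1] := mu01 e.
  rewrite /= mulr1 mulr0 expR0; apply/andP; split.
    by rewrite addr_ge0 ?mulr_ge0 ?expR_ge0 ?subr_ge0.
  apply: le_trans (expR_ge1Dx _); lra.
by apply: eq_bigr => a _; rewrite expR_sum.
Qed.

(* Exchanging the coordinates outside [P] between two independent copies
   preserves their joint law. *)
Lemma bern_mean_freeze (P : pred I)
    (H : {ffun I -> bool} -> {ffun I -> bool} -> R) :
  (forall a a' b : {ffun I -> bool}, (forall e, ~~ P e -> a e = a' e) ->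
     H a b = H a' b) ->
  (forall a b b' : {ffun I -> bool}, (forall e, P e -> b e = b' e) -> H a b = H a b') ->
  bern_mean (fun a => H a a) = bern_mean (fun b => bern_mean (fun a => H a b)).
Proof.
move=> H1 H2.
pose mix (a b : {ffun I -> bool}) := [ffun e => if P e then a e else b e].
pose sw (ab : {ffun I -> bool} * {ffun I -> bool}) :=
  (mix ab.1 ab.2, mix ab.2 ab.1).
have swK : involutive sw.
  by case=> a b; rewrite /sw /=; congr (_, _); apply/ffunP => e;
    rewrite !ffunE; case: (P e).
transitivity (\sum_a \sum_b bern_weight a * bern_weight b * H a a).
  apply: eq_bigr => a _; rewrite -mulr_suml -mulr_sumr bern_weight_sum.
  by rewrite mulr1.
rewrite pair_bigA /= (reindex_inj (inv_inj swK)) /=.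
transitivity (\sum_(ab : {ffun I -> bool} * {ffun I -> bool})
   bern_weight ab.1 * bern_weight ab.2 * H ab.2 ab.1).
  apply: eq_bigr => -[a b] _ /=; congr (_ * _).
    rewrite /bern_weight -!big_split /=; apply: eq_bigr => e _.
    by rewrite !ffunE; case: (P e); rewrite // mulrC.
  rewrite (H1 _ b) => [|e /negbTE eP]; last by rewrite !ffunE eP.
  by apply: H2 => e eP; rewrite ffunE eP.
rewrite -(pair_bigA _ (fun a b => bern_weight a * bern_weight b * H b a)) /=.
apply: eq_bigr => a _; rewrite mulr_sumr; apply: eq_bigr => b _.
by rewrite mulrA.
Qed.

End BernoulliProduct.

(** * Linear forms in the edges and their exponential moments *)

Section SymmetricSums.
Context {R : realType} {n : nat}.
Implicit Types (g : 'I_n * 'I_n -> R) (w : 'I_n -> 'I_n -> R).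

Definition symmetrize g (i j : 'I_n) : R :=
  if (i < j)%N then g (i, j) else if (j < i)%N then g (j, i) else 0.

(** An undirected edge is one variable and collects the weights of both orientations, which turns a
    double sum into a linear form in independent coordinates. *)
Lemma symmetrize_sum w g :
  \sum_i \sum_j w i j * symmetrize g i j =
  \sum_(e : 'I_n * 'I_n | (e.1 < e.2)%N) (w e.1 e.2 + w e.2 e.1) * g e.
Proof.
rewrite pair_bigA /= (bigID (fun e : 'I_n * 'I_n => (e.1 < e.2)%N)) /=.
under [in RHS]eq_bigr do rewrite mulrDl.
rewrite big_split /=; congr (_ + _).
  by apply: eq_bigr => -[i j] /= ij; rewrite /symmetrize ij.
pose sw (e : 'I_n * 'I_n) := (e.2, e.1).
have swK : involutive sw by case.
rewrite [RHS](reindex_inj (inv_inj swK)) /=.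
rewrite (bigID (fun e : 'I_n * 'I_n => (e.2 < e.1)%N)) /= [X in _ + X]big1.
  rewrite addr0; apply: eq_big => -[i j] /=.
    by rewrite -leqNgt; apply: andb_idl; exact: ltnW.
  by move=> /andP[/negbTE ij ji]; rewrite /symmetrize ij ji.
move=> [i j] /= /andP[/negbTE ij /negbTE ji].
by rewrite /symmetrize ij ji mulr0.
Qed.

End SymmetricSums.

Section ExponentialBounds.
Context {R : realType}.

(** [expR (- 2^-1) >= 2^-1] gives [expR 2^-1 <= 2], to be squared. *)
Lemma expR1_le4 : expR 1 <= 4 :> R.
Proof.
have h : expR (2^-1) <= 2 :> R.
  have := expR_ge1Dx (- 2^-1 : R); rewrite expRN => h.
  have e0 := expR_gt0 (2^-1 : R).
  have : (1 + - 2^-1) * expR 2^-1 <= 1 :> R.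
    by rewrite -ler_pdivlMr // mul1r.
  lra.
have -> : expR 1 = expR 2^-1 * expR 2^-1 :> R.
  by rewrite -expRD; congr expR; lra.
have e0 := expR_ge0 (2^-1 : R).
have := ler_pM e0 e0 h h; lra.
Qed.

(** A crude Taylor remainder, from the tangent line bound at [y] and at [- y]; it controls the
    centred edges in [edge_moment]. *)
Lemma expR_second_order (y : R) : expR y - 1 - y <= y ^+ 2 * expR `|y|.
Proof.
have up : expR y <= 1 + y * expR y.
  have := expR_ge1Dx (- y); rewrite expRN => h.
  have : (1 + - y) * expR y <= 1 by rewrite -ler_pdivlMr ?expR_gt0 // mul1r.
  lra.
have [y0|y0] := leP 0 y.
  rewrite ger0_norm //; have := ler_wpM2l y0 up; lra.
have : 1 <= expR `|y| by rewrite -expR0 ler_expR.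
have := expR_ge1Dx y; have := sqr_ge0 y; rewrite expr2; nra.
Qed.

End ExponentialBounds.

Section EdgeMoments.
Context {R : realType} {n : nat} (mu : 'I_n * 'I_n -> R) (p : R).
Hypothesis mu01 : forall e, 0 <= mu e <= 1.
Hypothesis mup : forall e : 'I_n * 'I_n, (e.1 < e.2)%N -> mu e <= p.
Hypothesis mu_out : forall e : 'I_n * 'I_n, ~~ (e.1 < e.2)%N -> mu e = 0.
Hypothesis p0 : 0 <= p.

Local Notation N := (symmetrize mu).

Definition adjacency (a : {ffun 'I_n * 'I_n -> bool}) : 'I_n -> 'I_n -> R :=
  symmetrize (fun e => (a e)%:R).

Lemma edge_mean_bound i j : 0 <= N i j <= p.
Proof.
rewrite /symmetrize; case: ifP => [ij|_]; last case: ifP => [ji|_].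
- by have /andP[-> _] /= := mu01 (i, j); exact: mup.
- by have /andP[-> _] /= := mu01 (j, i); exact: mup.
- by rewrite lexx.
Qed.

Lemma adjacency_ge0 a i j : 0 <= adjacency a i j.
Proof. by rewrite /adjacency /symmetrize; do 2?case: ifP. Qed.

Variables (S D J : {set 'I_n}) (x : 'I_n -> 'I_n -> R).
Hypotheses (SD : forall i, i \in S -> i \notin D).
Hypotheses (SJ : forall i, i \in S -> i \notin J).
Hypotheses (DJ : forall i, i \in D -> i \notin J).

(* Every edge inside D is counted twice, which costs [expR 2]; the edges between
   S and J are counted once. *)
Lemma edge_moment :
  bern_mean mu (fun a => expR (\sum_(i in D) \sum_j adjacency a i j +
    \sum_(i in S) \sum_(j in J) x i j * (adjacency a i j - N i j))) <=
  expR (8 * n%:R * p * #|D|%:R +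
    \sum_(i in S) \sum_(j in J) p * (x i j ^+ 2 * expR `|x i j|)).
Proof.
pose w i j : R := (i \in D)%:R + (i \in S)%:R * (j \in J)%:R * x i j.
(* The rate [8] per endpoint in [D] covers both [expR 1 - 1 <= 8] and [expR 2 - 1 <= 16]. No edge
   mixes the two kinds of weight, since [D] is disjoint from [S] and from [J]. *)
pose f i j : R := 8 * (i \in D)%:R +
  (i \in S)%:R * (j \in J)%:R * (expR (x i j) - 1).
pose K := \sum_(i in S) \sum_(j in J) x i j * N i j.
have wE (g : 'I_n -> 'I_n -> R) : \sum_i \sum_j w i j * g i j =
    \sum_(i in D) \sum_j g i j + \sum_(i in S) \sum_(j in J) x i j * g i j.
  rewrite [X in X + _]big_mkcond [X in _ + X]big_mkcond -big_split /=.
  apply: eq_bigr => i _; rewrite [X in _ + (if _ then X else _)]big_mkcond /=.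
  rewrite /w; case: (i \in D); case: (i \in S) => /=;
    rewrite ?addr0 ?add0r -?big_split /=; try apply: eq_bigr => j _;
    try (by case: (j \in J); rewrite /=; ring).
  by rewrite big1 // => j _; ring.
have fE (g : 'I_n -> 'I_n -> R) : \sum_i \sum_j f i j * g i j =
    8 * (\sum_(i in D) \sum_j g i j) +
    \sum_(i in S) \sum_(j in J) (expR (x i j) - 1) * g i j.
  rewrite mulr_sumr [X in X + _]big_mkcond [X in _ + X]big_mkcond -big_split /=.
  apply: eq_bigr => i _; rewrite [X in _ + (if _ then X else _)]big_mkcond /=.
  rewrite /f; case: (i \in D); case: (i \in S) => /=;
    rewrite ?mulr_sumr ?addr0 ?add0r -?big_split /=; try apply: eq_bigr => j _;
    try (by case: (j \in J); rewrite /=; ring).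
  by rewrite big1 // => j _; ring.
have expE a : \sum_(i in D) \sum_j adjacency a i j +
    \sum_(i in S) \sum_(j in J) x i j * (adjacency a i j - N i j) =
    \sum_(e : 'I_n * 'I_n) (if (e.1 < e.2)%N then w e.1 e.2 + w e.2 e.1 else 0) * (a e)%:R - K.
  have -> : \sum_(i in S) \sum_(j in J) x i j * (adjacency a i j - N i j) =
      \sum_(i in S) \sum_(j in J) x i j * adjacency a i j - K.
    rewrite /K -sumrB; apply: eq_bigr => i _; rewrite -sumrB.
    by apply: eq_bigr => j _; rewrite mulrBr.
  rewrite addrA -wE /adjacency symmetrize_sum; congr (_ - _).
  rewrite big_mkcond /=; apply: eq_bigr => e _.
  by case: ifP => _; rewrite ?mul0r.
under [X in bern_mean _ X]eq_fun do rewrite expE expRD mulrC.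
rewrite bern_meanZ.
apply: (le_trans (ler_wpM2l (expR_ge0 _) (bern_mean_expR mu01 _))).
rewrite -expRD ler_expR.
have step : \sum_(e : 'I_n * 'I_n) mu e * (expR (if (e.1 < e.2)%N then w e.1 e.2 + w e.2 e.1
    else 0) - 1) <= \sum_i \sum_j f i j * N i j.
  rewrite symmetrize_sum [leRHS]big_mkcond /=; apply: ler_sum => -[i j] _ /=.
  case: ifPn => ij; last by rewrite mu_out // mul0r.
  rewrite mulrC ler_wpM2r //; first by have /andP[] := mu01 (i, j).
  have e4 : expR 1 <= 4 :> R := expR1_le4.
  have e16 : expR (1 + 1) <= 16 :> R.
    by rewrite expRD; have := ler_pM (expR_ge0 _) (expR_ge0 _) e4 e4; lra.
  have ex (s : 'I_n) : s \in S -> (s \in D) = false /\ (s \in J) = false.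
    by move=> sS; split; apply/negbTE; [exact: SD|exact: SJ].
  have dj (s : 'I_n) : s \in D -> (s \in J) = false by move/DJ/negbTE.
  rewrite /w /f.
  have [iS|iS] := boolP (i \in S); have [jS|jS] := boolP (j \in S);
    rewrite ?(ex _ iS).1 ?(ex _ iS).2 ?(ex _ jS).1 ?(ex _ jS).2
      ?mulr0 ?mul0r ?mulr1 ?mul1r ?add0r ?addr0 ?expR0 ?subrr //.
  - case: (boolP (j \in D)) => jD; rewrite ?(dj _ jD) /=.
      by rewrite !mul0r !(add0r, addr0); lra.
    by case: (j \in J); rewrite /= !(mul0r, mul1r, mulr0, add0r, addr0) ?expR0 ?subrr.
  - case: (boolP (i \in D)) => iD; rewrite ?(dj _ iD) /=.
      by rewrite !mul0r !(add0r, addr0); lra.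
    by case: (i \in J); rewrite /= !(mul0r, mul1r, mulr0, add0r, addr0) ?expR0 ?subrr.
  - by case: (i \in D); case: (j \in D);
      rewrite /= !(mulr0, mulr1, mul0r, add0r, addr0) ?expR0 ?subrr //; lra.
apply: le_trans (lerD (lexx (- K)) step) _.
rewrite fE addrCA; apply: lerD.
  rewrite -2!mulrA ler_wpM2l //.
  apply: (@le_trans _ _ (\sum_(i in D) \sum_(j < n) p)).
    by apply: ler_sum => i _; apply: ler_sum => j _; have /andP[] := edge_mean_bound i j.
  by rewrite !sumr_const card_ord -mulr_natr -mulr_natr; lra.
(* Centering subtracts [x i j * N i j], leaving the remainder [expR (x i j) - 1 - x i j]. *)
rewrite /K addrC -sumrB; apply: ler_sum => i iS; rewrite -sumrB.
apply: ler_sum => j jJ; rewrite -mulrBl mulrC.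
have /andP[N0 Np] := edge_mean_bound i j.
apply: (@le_trans _ _ (N i j * (x i j ^+ 2 * expR `|x i j|))).
  by rewrite ler_wpM2l // expR_second_order.
by rewrite ler_wpM2r // mulr_ge0 ?sqr_ge0 ?expR_ge0.
Qed.

End EdgeMoments.

(** * Exponential moments of quadratic forms in the edges *)

Section GaussianMixture.
Context {R : realType}.

(* Rounding the maximizer of [l => 8 l y - 4 l ^ 2] to an integer loses at most
   a factor [expR 4]. *)
Lemma expR_sqr_mixture (kappa z : R) : 0 <= kappa ->
  exists2 l : nat, l%:R <= `|z| * Num.sqrt kappa / 2 &
    expR (kappa * z ^+ 2) <=
    expR 4 * expR (- (4 * l%:R ^+ 2)) * expR (4 * Num.sqrt kappa * l%:R * `|z|).
Proof.
move=> k0; set y := `|z| * Num.sqrt kappa / 2.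
have y0 : 0 <= y by rewrite !mulr_ge0 ?sqrtr_ge0.
exists (Num.truncn y); first by rewrite truncn_le.
have /andP[l1 l2] := truncn_itv y0; set l := Num.truncn y in l1 l2 *.
rewrite -natr1 in l2; rewrite -!expRD ler_expR.
have E1 : kappa * z ^+ 2 = 4 * y ^+ 2.
  by rewrite -(real_normK (num_real z)) -[in LHS](sqr_sqrtr k0) /y; field.
have E2 : 4 * Num.sqrt kappa * l%:R * `|z| = 8 * l%:R * y.
  by rewrite /y; field.
rewrite E1 E2.
have : (y - l%:R) ^+ 2 <= 1 by rewrite expr_le1 ?subr_ge0 //; lra.
rewrite sqrrB; lra.
Qed.

(** Half of the weight [expR (- (4 * l%:R ^+ 2))] survives once the exponential moment has spent the
    other half; a geometric series then sums it. *)
Lemma expRN_sqr_le (l : nat) : expR (- (2 * l%:R ^+ 2)) <= 2^-1 ^+ l :> R.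
Proof.
apply: (@le_trans _ _ (expR (- l%:R))).
  rewrite ler_expR lerN2; have : l%:R <= l%:R ^+ 2 :> R.
    by rewrite -natrX ler_nat; case: l => // l; rewrite -mulnn leq_pmulr.
  have : 0 <= l%:R :> R by []. 
  lra.
rewrite -mulrN1 expRM_natl.
rewrite lerXn2r ?nnegrE ?expR_ge0 // expRN lef_pV2 ?posrE ?expR_gt0 //.
have := expR_ge1Dx (1 : R); lra.
Qed.

Lemma sum_half_le (N : nat) : \sum_(l < N) 2^-1 ^+ l <= 2 :> R.
Proof.
suff : \sum_(l < N) 2^-1 ^+ l = 2 - 2 * 2^-1 ^+ N :> R.
  have : 0 <= 2^-1 ^+ N :> R by rewrite exprn_ge0.
  lra.
elim: N => [|N IH]; first by rewrite big_ord0 expr0; lra.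
rewrite big_ord_recr /= IH exprS; lra.
Qed.

End GaussianMixture.

Section ClassMoment.
Context {R : realType} {n k : nat} (mu : 'I_n * 'I_n -> R) (p : R).
Hypothesis mu01 : forall e, 0 <= mu e <= 1.
Hypothesis mup : forall e : 'I_n * 'I_n, (e.1 < e.2)%N -> mu e <= p.
Hypothesis mu_out : forall e : 'I_n * 'I_n, ~~ (e.1 < e.2)%N -> mu e = 0.
Hypothesis p0 : 0 <= p.
Hypothesis k0 : (0 < k)%N.

Local Notation N := (symmetrize mu).

Variables (S D J : {set 'I_n}) (Q : 'M[R]_(n, k)).
Hypotheses (SD : forall i, i \in S -> i \notin D).
Hypotheses (SJ : forall i, i \in S -> i \notin J).
Hypotheses (DJ : forall i, i \in D -> i \notin J).
Variables (t0 t1 eta kappa : R).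
Hypotheses (t0_ge0 : 0 <= t0) (t1_ge0 : 0 <= t1) (kappa_ge0 : 0 <= kappa).
Hypothesis Q_rows : forall j, j \in J -> enorm (row j Q) <= t0.
Hypothesis Q_cols : forall a, \sum_(j in J) Q j a ^+ 2 <= 1.
Hypothesis Q_tail :
  \sum_(j in J | t1 < enorm (row j Q)) enorm (row j Q) ^+ 2 <= eta.

(** A row has [k] columns, each split into two parts; replacing all of them by the largest costs [k]
    for the columns and [4] for the square of a sum of two. *)
Local Notation K4 := (4 * k%:R * kappa).

Hypothesis small1 : 8 * K4 * p * expR (42 * K4 * n%:R * p * t1 ^+ 2) <= 1.
Hypothesis small0 : 8 * K4 * p * eta * expR (42 * K4 * n%:R * p * t0 ^+ 2) <= 1.

Definition row_deviation (a : {ffun 'I_n * 'I_n -> bool}) (i : 'I_n) (b : 'I_k) : R :=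
  \sum_(j in J) (adjacency a i j - N i j) * Q j b.

(** Rows of [Q] up to [t1] may carry all the mass but have a short range; rows between [t1] and [t0]
    have a longer range but mass at most [eta]. The two parts are balanced separately, by [small1]
    and [small0]. *)
Let part (m : bool) (j : 'I_n) : bool := (enorm (row j Q) <= t1) == m.
Let level (m : bool) : R := if m then t1 else t0.
(** A common bound on the integers produced by [expR_sqr_mixture], which keeps the mixture finite;
    [t0 + t1] dominates both levels. *)
Let Nmax : nat :=
  (Num.truncn (21 * n%:R * p * (t0 + t1) * Num.sqrt K4 / 2)).+1.
Let idx : Type := (bool * bool * 'I_k * 'I_Nmax)%type.
Let slope (l : nat) : R := 4 * Num.sqrt K4 * l%:R.
Let coef (t : idx) (j : 'I_n) : R :=
  let: (m, s, b, l) := t in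
  (-1) ^+ s * slope l * (if part m j then Q j b else 0).
(** The indicator discards slopes that the degree bound excludes, and so keeps [coef] bounded
    wherever [wt] is nonzero. *)
Let wt (t : idx) : R :=
  let: (m, s, b, l) := t in
  expR 4 * expR (- (4 * l%:R ^+ 2)) *
    (slope l <= 42 * K4 * n%:R * p * level m)%R%:R.

Let K4_ge0 : 0 <= K4. Proof. by rewrite !mulr_ge0. Qed.

Let level_ge0 m : 0 <= level m. Proof. by case: m. Qed.

Let wt_ge0 t : 0 <= wt t.
Proof. by case: t => [[[m s] b] l]; rewrite /wt !mulr_ge0 ?expR_ge0. Qed.

Let entry_le_row j b : `|Q j b| <= enorm (row j Q).
Proof.
rewrite -(ler_pXn2r (n := 2)) ?nnegrE ?enorm_ge0 // real_normK ?num_real //.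
rewrite enorm_sqr big_ord1 (bigD1 b) //= mxE lerDl.
by apply: sumr_ge0 => c _; exact: sqr_ge0.
Qed.

Let part_le m j b : j \in J -> `|if part m j then Q j b else 0| <= level m.
Proof.
move=> jJ; case: ifP => [|_]; last by rewrite normr0.
rewrite /part; case: m => /eqP h; apply: le_trans (entry_le_row j b) _ => //.
exact: Q_rows.
Qed.

(** Reduces a quadratic exponent to linear ones, to which [edge_moment] applies. One index, given by
    the largest deviation, its sign and its rounded slope, already suffices; the other terms are
    nonnegative. *)
Let row_mixture a i : \sum_(j in J) adjacency a i j < 20 * n%:R * p ->
  expR (kappa * \sum_b row_deviation a i b ^+ 2) <=
  \sum_(t : idx) wt t *
    expR (\sum_(j in J) coef t j * (adjacency a i j - N i j)).
Proof.
move=> deg.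
pose z m b := \sum_(j in J) (adjacency a i j - N i j) *
  (if part m j then Q j b else 0).
have zE b : row_deviation a i b = z true b + z false b.
  rewrite /row_deviation /z -big_split /=; apply: eq_bigr => j _.
  by rewrite /part; case: (enorm _ <= t1); rewrite /= mulr0 ?addr0 ?add0r.
pose F (mb : bool * 'I_k) := z mb.1 mb.2 ^+ 2.
have [[m b] mbP] : exists mb, forall mb', F mb' <= F mb.
  have [mb _ mbP] := @Order.TotalTheory.arg_maxP _ _ _ (true, Ordinal k0) predT F isT.
  by exists mb => mb'; exact: mbP.
have le1 : kappa * \sum_b row_deviation a i b ^+ 2 <= K4 * z m b ^+ 2.
  have -> : K4 * z m b ^+ 2 = kappa * (\sum_(c < k) 4 * z m b ^+ 2).
    by rewrite sumr_const card_ord -mulr_natr; ring.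
  rewrite ler_wpM2l //; apply: ler_sum => c _; rewrite zE.
  have := mbP (true, c); have := mbP (false, c); rewrite /F /=.
  have := sqr_ge0 (z true c - z false c); rewrite sqrrB sqrrD; lra.
(* The degree bound contributes [20] and the means contribute [1]. *)
have zL : `|z m b| <= 21 * n%:R * p * level m.
  apply: le_trans (ler_norm_sum _ _ _) _.
  apply: (@le_trans _ _ (\sum_(j in J) (adjacency a i j + p) * level m)).
    apply: ler_sum => j jJ; rewrite normrM.
    have [N0 Np] := andP (edge_mean_bound mu01 mup p0 i j).
    apply: ler_pM => //; last exact: part_le.
    have := adjacency_ge0 (R := R) a i j => A0.
    rewrite ler_norml; lra.
  rewrite -mulr_suml ler_wpM2r // big_split /= sumr_const.
  have : p *+ #|J| <= n%:R * p.
    rewrite -[p *+ _]mulr_natl ler_wpM2r // ler_nat -[X in (_ <= X)%N]card_ord.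
    exact: max_card.
  lra.
have [l ly exp_le] := expR_sqr_mixture (z m b) K4_ge0.
have lN : (l < Nmax)%N.
  rewrite /Nmax ltnS truncn_ge_nat; last first.
    by rewrite !mulr_ge0 ?sqrtr_ge0 ?addr_ge0.
  apply: le_trans ly _; rewrite ler_wpM2r // ler_wpM2r ?sqrtr_ge0 //.
  apply: le_trans zL _; rewrite ler_wpM2l ?mulr_ge0 //.
  by rewrite /level; case: (m); rewrite ?lerDl ?lerDr.
pose s : bool := z m b < 0.
have sz : `|z m b| = (-1) ^+ s * z m b.
  rewrite /s; case: ltP => h; rewrite /= ?expr1 ?expr0 ?mul1r ?mulN1r.
    by rewrite ltr0_norm.
  by rewrite ger0_norm.
pose t : idx := (m, s, b, Ordinal lN).
rewrite (bigD1 t) //=.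
apply: (@le_trans _ _ (wt t *
    expR (\sum_(j in J) coef t j * (adjacency a i j - N i j)))); last first.
  by rewrite lerDl sumr_ge0 // => t' _; rewrite mulr_ge0 ?expR_ge0.
apply: (@le_trans _ _ (expR (K4 * z m b ^+ 2))); first by rewrite ler_expR.
apply: le_trans exp_le _.
have -> : \sum_(j in J) coef t j * (adjacency a i j - N i j) =
    4 * Num.sqrt K4 * l%:R * `|z m b|.
  have alg (u v x y : R) : u * v * x * y = v * (u * (y * x)) by ring.
  rewrite sz /z !mulr_sumr; apply: eq_bigr => j _; exact: alg.
(* The slope is at most twice [K4] times the deviation, whence [42 = 2 * 21] in the indicator. *)
have -> : wt t = expR 4 * expR (- (4 * l%:R ^+ 2)).
  rewrite /wt /t /= (_ : _ <= _ = true) ?mulr1 //.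
  have sq : Num.sqrt K4 ^+ 2 = K4 by rewrite sqr_sqrtr.
  apply: (@le_trans _ _ (4 * Num.sqrt K4 * (`|z m b| * Num.sqrt K4 / 2))).
    by rewrite /slope ler_wpM2l ?mulr_ge0 ?sqrtr_ge0.
  have -> : 4 * Num.sqrt K4 * (`|z m b| * Num.sqrt K4 / 2) =
      2 * K4 * `|z m b| by rewrite -[in RHS]sq; field.
  have -> : 42 * K4 * n%:R * p * level m = 2 * K4 * (21 * n%:R * p * level m).
    by clear; ring.
  by rewrite ler_wpM2l // mulr_ge0.
by [].
Qed.

(** An index with integer [l] contributes at most [expR 4 * 2^-1 ^+ l]; there are [4 * k] choices of
    part, sign and column, and the geometric series is at most [2]. *)
Let mixture_total :
  \sum_(t : idx) wt t *
    expR (\sum_(j in J) p * (coef t j ^+ 2 * expR `|coef t j|)) <=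
  8 * expR 4 * k%:R.
Proof.
apply: (@le_trans _ _ (\sum_(t : idx) expR 4 * 2^-1 ^+ t.2)); last first.
  rewrite -mulr_sumr.
  have -> : \sum_(t : idx) 2^-1 ^+ t.2 =
      \sum_(u : bool * bool * 'I_k) \sum_(l < Nmax) 2^-1 ^+ l :> R.
    by rewrite pair_bigA.
  rewrite sumr_const (_ : #|_| = (4 * k)%N); last first.
    by rewrite !card_prod card_bool card_ord.
  rewrite -[X in _ * X]mulr_natr natrM.
  have e4 := expR_ge0 (4 : R).
  have := ler_wpM2l (mulr_ge0 (ler0n R k) e4) (sum_half_le (R := R) Nmax); lra.
apply: ler_sum => -[[[m s] b] l] _ /=.
rewrite /wt; case: (boolP (slope l <= _)) => [lm|_]; last first.
  by rewrite mulr0 mul0r mulr_ge0 ?expR_ge0 ?exprn_ge0.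
rewrite mulr1 -mulrA ler_wpM2l ?expR_ge0 // -expRD.
apply: le_trans (expRN_sqr_le l); rewrite ler_expR.
pose V m : R := if m then 1 else eta.
pose c m : R := 42 * K4 * n%:R * p * level m ^+ 2.
have sl0 : 0 <= slope l by rewrite /slope !mulr_ge0 ?sqrtr_ge0.
have sV : \sum_(j in J) (if part m j then Q j b else 0) ^+ 2 <= V m.
  rewrite /V /part; case: m {lm} => /=.
    apply: le_trans (Q_cols b); apply: ler_sum => j _.
    by case: ifP => // _; rewrite expr0n sqr_ge0.
  apply: le_trans Q_tail; rewrite big_mkcondr /=; apply: ler_sum => j _.
  rewrite ltNge; case: (enorm _ <= t1) => /=; first by rewrite expr0n.
  rewrite -(real_normK (num_real (Q j b))).
  by rewrite ler_pXn2r ?nnegrE ?enorm_ge0.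
have small : 8 * K4 * p * V m * expR (c m) <= 1.
  by rewrite /V /c /level; case: (m); rewrite ?mulr1.
have : \sum_(j in J) p * (coef (m, s, b, l) j ^+ 2 *
    expR `|coef (m, s, b, l) j|) <= p * slope l ^+ 2 * V m * expR (c m).
  apply: (@le_trans _ _ (\sum_(j in J) (p * slope l ^+ 2 * expR (c m)) *
      (if part m j then Q j b else 0) ^+ 2)); last first.
    rewrite -mulr_sumr [leRHS]mulrAC ler_wpM2l //.
    by rewrite !mulr_ge0 ?sqr_ge0 ?expR_ge0.
  apply: ler_sum => j jJ; rewrite /coef.
  set x := if part m j then Q j b else 0.
  have -> : ((-1) ^+ s * slope l * x) ^+ 2 = slope l ^+ 2 * x ^+ 2.
    by rewrite !exprMn sqrr_sign mul1r.
  have -> : p * slope l ^+ 2 * expR (c m) * x ^+ 2 =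
      p * (slope l ^+ 2 * x ^+ 2 * expR (c m)) by ring.
  apply: ler_wpM2l => //; apply: ler_wpM2l; first by rewrite mulr_ge0 ?sqr_ge0.
  rewrite ler_expR.
  rewrite 2!normrM normr_sign mul1r (ger0_norm sl0).
  apply: (@le_trans _ _ (42 * K4 * n%:R * p * level m * level m)).
    by apply: ler_pM => //; exact: (part_le m b jJ).
  by rewrite /c expr2 [leRHS]mulrA.
have sq : Num.sqrt K4 ^+ 2 = K4 by rewrite sqr_sqrtr.
(* [slope l ^+ 2] is [16 * K4 * l%:R ^+ 2], so the smallness hypotheses cap the exponent at
   [2 * l%:R ^+ 2]. *)
have -> : p * slope l ^+ 2 * V m * expR (c m) =
    2 * l%:R ^+ 2 * (8 * K4 * p * V m * expR (c m)).
  by rewrite -[in RHS]sq /slope; ring.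
have := ler_wpM2l (mulr_ge0 (ler0n R 2) (sqr_ge0 (l%:R : R))) small.
lra.
Qed.

(** A Chernoff bound with slope [1] for the degrees in [D], and the mixture for the rows in [S]. The
    product of mixtures is expanded over choice functions [f], so that each term is one linear
    exponent joint in [D] and [S]; after [edge_moment] the sum is folded back into a product. *)
Lemma class_moment :
  bern_mean mu (fun a =>
    \prod_(i in D) (20 * n%:R * p <= \sum_j adjacency a i j)%R%:R *
    \prod_(i in S) ((\sum_(j in J) adjacency a i j < 20 * n%:R * p)%R%:R *
       expR (kappa * \sum_b row_deviation a i b ^+ 2))) <=
  expR (- (12 * n%:R * p)) ^+ #|D| * (8 * expR 4 * k%:R) ^+ #|S|.
Proof.
set tau := 20 * n%:R * p.
(* Default value of the choice functions outside [S]. *)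
pose t_def : idx := (true, true, Ordinal k0, ord0).
pose lin (f : {ffun 'I_n -> idx}) a := expR (\sum_(i in D) \sum_j adjacency a i j +
  \sum_(i in S) \sum_(j in J) coef (f i) j * (adjacency a i j - N i j)).
apply: (@le_trans _ _ (bern_mean mu (fun a => expR (- tau) ^+ #|D| *
    \sum_(f in pffun_on t_def (mem S) (mem predT))
      (\prod_(i in S) wt (f i)) * lin f a))).
  apply: bern_mean_le => // a.
  apply: (@le_trans _ _ (\prod_(i in D) expR (- tau + \sum_j adjacency a i j) *
    \prod_(i in S) \sum_(t : idx) wt t *
      expR (\sum_(j in J) coef t j * (adjacency a i j - N i j)))).
    apply: ler_pM.
    - by apply: prodr_ge0 => i _.
    - by apply: prodr_ge0 => i _; rewrite mulr_ge0 ?expR_ge0.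
    - apply: ler_prod => i _; rewrite ler0n /=; case: (leP tau) => h /=.
        have : expR 0 <= expR (- tau + \sum_j adjacency a i j).
          by rewrite ler_expR addrC subr_ge0.
        by rewrite expR0.
      exact: expR_ge0.
    - apply: ler_prod => i _; rewrite mulr_ge0 ?expR_ge0 //=.
      case: (ltP _ tau) => h; rewrite ?mul1r ?mul0r; first exact: row_mixture.
      by apply: sumr_ge0 => t _; rewrite mulr_ge0 ?expR_ge0.
  rewrite (big_distr_big t_def) /= le_eqVlt; apply/orP; left; apply/eqP.
  rewrite -prodr_const mulr_sumr [RHS]mulr_sumr; apply: eq_bigr => f _.
  rewrite /lin expRD 2!expR_sum.
  under eq_bigr do rewrite expRD.
  under [X in _ * X = _]eq_bigr do rewrite expR_sum.
  rewrite !big_split /=; under [X in _ = _ * (_ * (_ * X))]eq_bigr do rewrite expR_sum.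
  ring.
rewrite bern_meanZ bern_mean_sum.
apply: (@le_trans _ _ (expR (- tau) ^+ #|D| *
    \sum_(f in pffun_on t_def (mem S) (mem predT)) (\prod_(i in S) wt (f i)) *
      (expR (8 * n%:R * p * #|D|%:R) *
       \prod_(i in S) expR (\sum_(j in J) p * (coef (f i) j ^+ 2 *
         expR `|coef (f i) j|))))).
  rewrite ler_wpM2l ?exprn_ge0 ?expR_ge0 //; apply: ler_sum => f _.
  rewrite bern_meanZ ler_wpM2l ?prodr_ge0 // -expR_sum -expRD.
  exact: edge_moment.
(* The threshold [20] minus the rate [8] of the exponential moment. *)
have -> : expR (- (12 * n%:R * p)) ^+ #|D| =
    expR (- tau) ^+ #|D| * expR (8 * n%:R * p * #|D|%:R).
  by rewrite -!expRM_natl -expRD; congr expR; rewrite /tau; ring.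
rewrite -[leRHS]mulrA ler_wpM2l ?exprn_ge0 ?expR_ge0 //.
under eq_bigr do rewrite mulrCA -big_split /=.
rewrite -mulr_sumr ler_wpM2l ?expR_ge0 //.
rewrite -(big_distr_big t_def (mem S) predT (fun i t => wt t *
   expR (\sum_(j in J) p * (coef t j ^+ 2 * expR `|coef t j|)))) /=.
rewrite -prodr_const; apply: ler_prod => i _; rewrite mixture_total andbT.
by apply: sumr_ge0 => t _; rewrite mulr_ge0 ?expR_ge0.
Qed.

End ClassMoment.

(** * Summation over all pairs [(S, D)] *)

Lemma sum_expr_card {R : realType} (I : finType) (x : R) :
  \sum_(S : {set I}) x ^+ #|S| = (1 + x) ^+ #|I|.
Proof.
rewrite addrC -prodr_const bigA_distr; apply: eq_bigr => S _.
by rewrite -prodr_const big_mkcond.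
Qed.

Section ClassSum.
Context {R : realType} {n k : nat} (mu : 'I_n * 'I_n -> R) (p : R).
Hypothesis mu01 : forall e, 0 <= mu e <= 1.
Hypothesis mup : forall e : 'I_n * 'I_n, (e.1 < e.2)%N -> mu e <= p.
Hypothesis mu_out : forall e : 'I_n * 'I_n, ~~ (e.1 < e.2)%N -> mu e = 0.
Hypothesis p0 : 0 <= p.
Hypothesis k0 : (0 < k)%N.
Local Notation conf := {ffun 'I_n * 'I_n -> bool}.

Definition outside (S D : {set 'I_n}) : {set 'I_n} := ~: (S :|: D).

Definition restrict_conf (S D : {set 'I_n}) (a : conf) : conf :=
  [ffun e => [&& e.1 \in outside S D, e.2 \in outside S D & a e]].

(** Apart from [Q], only edges touching [S] or [D] enter. Degrees of rows in [S] are counted inside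
    [outside S D] alone: the bound follows from being untrimmed and suffices for the range of the
    deviations. *)
Definition class_weight (kappa : R) (S D : {set 'I_n}) (Q : 'M[R]_(n, k))
    (a : conf) : R :=
  \prod_(i in D) (20 * n%:R * p <= \sum_j adjacency a i j)%R%:R *
  \prod_(i in S) ((\sum_(j in outside S D) adjacency a i j < 20 * n%:R * p)%R%:R *
    expR (kappa * \sum_b row_deviation mu (outside S D) Q a i b ^+ 2)).

Lemma class_weight_ge0 kappa S D Q a : 0 <= class_weight kappa S D Q a.
Proof.
apply: mulr_ge0; apply: prodr_ge0 => i _ //.
Qed.

Definition spread_out (t0 t1 eta : R) (J : {set 'I_n}) (Q : 'M[R]_(n, k)) : Prop :=
  [/\ forall j, j \in J -> enorm (row j Q) <= t0,
      forall a, \sum_(j in J) Q j a ^+ 2 <= 1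
    & \sum_(j in J | t1 < enorm (row j Q)) enorm (row j Q) ^+ 2 <= eta].

Variables (t0 t1 eta kappa : R) (Q : {set 'I_n} -> {set 'I_n} -> conf -> 'M[R]_(n, k)).
Hypotheses (t0_ge0 : 0 <= t0) (t1_ge0 : 0 <= t1) (kappa_ge0 : 0 <= kappa).
Hypothesis Q_spread : forall S D a, spread_out t0 t1 eta (outside S D) (Q S D a).
Local Notation K4 := (4 * k%:R * kappa).
Hypothesis small1 : 8 * K4 * p * expR (42 * K4 * n%:R * p * t1 ^+ 2) <= 1.
Hypothesis small0 : 8 * K4 * p * eta * expR (42 * K4 * n%:R * p * t0 ^+ 2) <= 1.

(** [Q] reads the edges inside [outside S D] and the rest of the weight reads the others, so
    [bern_mean_freeze] lets [Q] be held fixed and [class_moment] applies. *)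
Lemma class_weight_mean (S D : {set 'I_n}) : (forall i, i \in S -> i \notin D) ->
  bern_mean mu (fun a => class_weight kappa S D (Q S D (restrict_conf S D a)) a) <=
  expR (- (12 * n%:R * p)) ^+ #|D| * (8 * expR 4 * k%:R) ^+ #|S|.
Proof.
move=> SD; pose P (e : 'I_n * 'I_n) :=
  (e.1 \in outside S D) && (e.2 \in outside S D).
have adjE (a a' : conf) i j : (forall e, ~~ P e -> a e = a' e) ->
    i \notin outside S D -> adjacency a i j = adjacency a' i j :> R.
  move=> aa iJ; rewrite /adjacency /symmetrize.
  have h1 : ~~ P (i, j) by rewrite /P /= negb_and iJ.
  have h2 : ~~ P (j, i) by rewrite /P /= negb_and iJ orbT.
  by rewrite (aa _ h1) (aa _ h2).
have SJ i : i \in S -> i \notin outside S D.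
  by move=> iS; rewrite !inE negbK iS.
have DJ i : i \in D -> i \notin outside S D.
  by move=> iD; rewrite !inE negbK iD orbT.
rewrite (bern_mean_freeze mu (P := P)
  (H := fun a b => class_weight kappa S D (Q S D (restrict_conf S D b)) a)).
- rewrite -[leRHS](bern_mean_cst mu); apply: bern_mean_le => // b.
  have [h1 h2 h3] := Q_spread S D (restrict_conf S D b).
  exact: (class_moment mu01 mup mu_out p0 k0 SD SJ DJ t0_ge0 t1_ge0 kappa_ge0
    h1 h2 h3 small1 small0).
- move=> a a' b aa; rewrite /class_weight; congr (_ * _).
    apply: eq_bigr => i iD.
    rewrite (eq_bigr (adjacency a' i)) // => j _; apply: adjE => //; exact: DJ.
  apply: eq_bigr => i iS; rewrite (eq_bigr (adjacency a' i)) => [|j _]; last first.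
    by apply: adjE => //; exact: SJ.
  congr (_ * expR (_ * _)).
  apply: eq_bigr => c _; congr (_ ^+ 2); rewrite /row_deviation.
  by apply: eq_bigr => j _; rewrite (adjE a a') //; exact: SJ.
- move=> a b b' bb; congr (class_weight _ _ _ (Q S D _) _).
  apply/ffunP => e; rewrite !ffunE; case: (boolP (P e)) => [Pe|].
    by rewrite (bb _ Pe).
  by rewrite /P !andbA => /negbTE ->.
Qed.

(** The random pair of bad and trimmed sets is replaced by a sum over all disjoint pairs; [x]
    penalizes each bad row, to pay for the number of choices of [S]. *)
Definition class_sum (x : R) (a : conf) : R :=
  \sum_(S : {set 'I_n}) \sum_(D : {set 'I_n} | S :&: D == finset.set0)
    x ^+ #|S| * class_weight kappa S D (Q S D (restrict_conf S D a)) a.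

(** Dropping disjointness factorizes the double sum into two binomial sums, each bounded through
    [1 + u <= expR u]. *)
Lemma class_sum_mean x : 0 <= x ->
  bern_mean mu (class_sum x) <=
  expR (n%:R * (x * (8 * expR 4 * k%:R) + expR (- (12 * n%:R * p)))).
Proof.
move=> x0; set c := 8 * expR 4 * k%:R; set y := expR (- _).
have c0 : 0 <= c by rewrite !mulr_ge0 ?expR_ge0.
have y0 : 0 <= y by exact: expR_ge0.
rewrite /class_sum bern_mean_sum.
apply: (@le_trans _ _ (\sum_(S : {set 'I_n}) \sum_(D : {set 'I_n})
    (x * c) ^+ #|S| * y ^+ #|D|)).
  apply: ler_sum => S _; rewrite bern_mean_sum big_mkcond /=.
  apply: ler_sum => D _; case: ifP => [/eqP SD|_]; last first.
    by rewrite mulr_ge0 ?exprn_ge0 ?mulr_ge0.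
  rewrite bern_meanZ exprMn -mulrA ler_wpM2l ?exprn_ge0 // [leRHS]mulrC.
  apply: class_weight_mean => i iS; apply/negP => iD.
  have : i \in S :&: D by rewrite inE iS iD.
  by rewrite SD inE.
rewrite -big_distrlr /= !sum_expr_card card_ord mulrDr expRD.
have le1 (u : R) : 0 <= u -> (1 + u) ^+ n <= expR (n%:R * u).
  move=> u0; rewrite expRM_natl lerXn2r ?nnegrE ?expR_ge0 ?addr_ge0 //.
  exact: expR_ge1Dx.
apply: ler_pM; rewrite ?exprn_ge0 ?addr_ge0 ?mulr_ge0 //; apply: le1 => //.
by rewrite mulr_ge0.
Qed.

Lemma class_sum_ge (x : R) (a : conf) (S D : {set 'I_n}) : 0 <= x -> S :&: D = finset.set0 ->
  x ^+ #|S| * class_weight kappa S D (Q S D (restrict_conf S D a)) a <=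
  class_sum x a.
Proof.
move=> x0 SD; rewrite /class_sum (bigD1 S) //= (bigD1 D) /=; last exact/eqP.
rewrite -addrA lerDl addr_ge0 //; apply: sumr_ge0 => S' _; last first.
  by apply: sumr_ge0 => D' _; rewrite mulr_ge0 ?exprn_ge0 ?class_weight_ge0.
by rewrite mulr_ge0 ?exprn_ge0 ?class_weight_ge0.
Qed.

(** The pair of empty sets contributes [1]. *)
Lemma class_sum_ge1 (x : R) (a : conf) : 0 <= x -> 1 <= class_sum x a.
Proof.
move=> x0; apply: le_trans (class_sum_ge a x0 (finset.setI0 finset.set0)).
by rewrite /class_weight cards0 expr0 mul1r !big_set0 mulr1.
Qed.

End ClassSum.

(** * The law of the adjacency matrix *)

Section SbmLaw.
Context {R : realType} {d : measure_display} {T : measurableType d}.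
Context (P : probability T R) (n k : nat) (z : 'I_n -> 'I_k) (p q : R).
Context (A : T -> 'M[R]_n).
Hypotheses (q0 : 0 < q) (qp : q < p) (p1 : p <= 1).
Hypothesis hA : is_sbm P z p q A.
Local Notation conf := {ffun 'I_n * 'I_n -> bool}.

Definition edge_prob (e : 'I_n * 'I_n) : R :=
  if (e.1 < e.2)%N then if z e.1 == z e.2 then p else q else 0.

(** Coordinates off the strict upper triangle are [false], matching the probability [0] that
    [edge_prob] gives them, so that the law is a product over all pairs. *)
Definition edge_conf (w : T) : conf :=
  [ffun e : 'I_n * 'I_n => (e.1 < e.2)%N && (A w e.1 e.2 == 1)].

Lemma edge_prob01 e : 0 <= edge_prob e <= 1.
Proof.
rewrite /edge_prob; case: ifP => _; last by rewrite lexx ler01.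
case: ifP => _; first by rewrite p1 ltW // (lt_trans q0).
by rewrite (ltW q0) (le_trans (ltW qp)).
Qed.

Lemma sbm_adjacency w i j : A w i j = adjacency (edge_conf w) i j.
Proof.
have Aval i' j' : A w i' j' = (A w i' j' == 1)%:R.
  by case: (sbm_01 hA w i' j') => ->; rewrite ?eqxx // eq_sym oner_eq0.
rewrite /adjacency /symmetrize !ffunE /=.
case: ltngtP => [ij|ji|/val_inj ij].
- exact: Aval.
- by rewrite -Aval -[in LHS](sbm_sym hA) mxE.
- by rewrite ij (sbm_diag hA).
Qed.

Lemma edge_measurable (i j : 'I_n) (c : R) :
  measurable ((fun w => A w i j) @^-1` [set c]).
Proof.
rewrite -[X in measurable X]setTI.
exact: (sbm_measurable hA i j) (measurable_set1 c).
Qed.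

Lemma edge_prob1 (i j : 'I_n) : (i < j)%N ->
  P ((fun w => A w i j) @^-1` [set 1]) = (edge_prob (i, j))%:E.
Proof.
move=> ij; rewrite /edge_prob /= ij -(sbm_mean hA ij).
have AE : (fun w => A w i j) = \1_((fun w => A w i j) @^-1` [set 1]).
  apply/funext => w; rewrite indicE.
  case: (sbm_01 hA w i j) => Aw; rewrite Aw; apply/esym.
    by rewrite memNset //= Aw => /eqP; rewrite eq_sym oner_eq0.
  by rewrite mem_set.
by rewrite [in RHS]AE (expectation_indic P (edge_measurable i j 1)).
Qed.

Lemma edge_prob0 (i j : 'I_n) : (i < j)%N ->
  P ((fun w => A w i j) @^-1` [set 0]) = (1 - edge_prob (i, j))%:E.
Proof.
move=> ij; have -> : (fun w => A w i j) @^-1` [set 0] =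
    ~` ((fun w => A w i j) @^-1` [set 1]).
  apply/seteqP; split => w /=.
    by move=> -> /eqP; rewrite eq_sym oner_eq0.
  by case: (sbm_01 hA w i j).
rewrite probability_setC; first by rewrite edge_prob1.
exact: edge_measurable.
Qed.

Lemma edge_conf_law (b : conf) :
  P [set w | edge_conf w = b] = (bern_weight edge_prob b)%:E.
Proof.
case: (pselect (forall e, b e -> (e.1 < e.2)%N)) => [b_up|]; last first.
  (* For a graph with an edge off the triangle both sides are [0]. *)
  move=> /existsNP[e /not_implyP[be /negP eN]].
  rewrite (_ : [set w | _] = set0) ?measure0.
    rewrite /bern_weight (bigD1 e) //= be /edge_prob (negbTE eN).
    by rewrite mul0r.
  rewrite -subset0 => w /= wb; move: be; rewrite -wb ffunE.
  by rewrite (negbTE eN).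
pose Dn : {set 'I_n * 'I_n} := [set e : 'I_n * 'I_n | (e.1 < e.2)%N]%SET.
pose B (e : 'I_n * 'I_n) : set R := [set (b e)%:R].
have := sbm_indep hA (B := B) (fintype.subxx Dn) (fun e => measurable_set1 _).
rewrite (_ : [set w | _] = [set w | edge_conf w = b]) => [->|].
  rewrite /bern_weight [in RHS](bigID (fun e => e \in Dn)) /= [X in (_ * X)%R]big1.
    rewrite mulr1 -prodEFin; apply: eq_bigr => -[i j]; rewrite inE /= => ij.
    by rewrite /B; case: (b (i, j)); rewrite ?edge_prob1 ?edge_prob0.
  move=> e; rewrite inE => eN; rewrite /edge_prob (negbTE eN).
  by case: (boolP (b e)) => [/b_up|_]; rewrite ?(negbTE eN) // subr0.
apply/seteqP; split => w /= h.
  apply/ffunP => e; rewrite ffunE; case: (boolP (e.1 < e.2)%N) => eu /=.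
    have := h e; rewrite inE => /(_ eu) /= ->.
    by case: (b e); rewrite ?eqxx // eq_sym oner_eq0.
  by apply/esym/negbTE; apply: contra eu; exact: b_up.
move=> e; rewrite inE => eu; rewrite /B /= -h ffunE eu /=.
by case: (sbm_01 hA w e.1 e.2) => ->; rewrite ?eqxx // eq_sym oner_eq0.
Qed.

Lemma edge_conf_measurable (b : conf) : measurable [set w | edge_conf w = b].
Proof.
have -> : [set w | edge_conf w = b] = \bigcap_(e in [set` predT])
    [set w | edge_conf w e = b e].
  apply/seteqP; split => w /=; first by move=> <-.
  by move=> h; apply/ffunP => e; exact: h.
apply: fin_bigcap_measurable => [|e _]; first exact: finite_finset.
case: (boolP (e.1 < e.2)%N) => eu; last first.
  rewrite (_ : [set w | _] = if b e then set0 else setT).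
    by case: (b e).
  apply/seteqP; split => w /=; rewrite ffunE (negbTE eu) /=.
    by case: (b e).
  by case: (b e).
rewrite (_ : [set w | _] = if b e then (fun w => A w e.1 e.2) @^-1` [set 1]
    else ~` ((fun w => A w e.1 e.2) @^-1` [set 1])).
  by case: (b e); [|apply: measurableC]; exact: edge_measurable.
apply/seteqP; split => w /=; rewrite ffunE eu /=.
  by move=> <-; case: eqP.
by case: (b e) => /eqP => [->|/negbTE ->].
Qed.

Lemma edge_conf_indic (g : conf -> R) w :
  g (edge_conf w) = \sum_(b : conf) g b * \1_[set w | edge_conf w = b] w.
Proof.
rewrite (bigD1 (edge_conf w)) //= indicE mem_set // mulr1.
rewrite big1 ?addr0 // => b /eqP bw; rewrite indicE memNset ?mulr0 //=.
by move/esym.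
Qed.

Lemma edge_conf_expectation (g : conf -> R) : (forall b, 0 <= g b) ->
  'E_P[fun w => g (edge_conf w)]%E = (bern_mean edge_prob g)%:E.
Proof.
move=> g0; rewrite unlock.
have mE (f : T -> R) : measurable_fun setT f ->
    measurable_fun setT (fun w => (f w)%:E).
  by move=> mf; exact: (measurableT_comp (@EFin_measurable R setT) mf).
under eq_integral do rewrite edge_conf_indic -sumEFin.
rewrite ge0_integral_sum //; last 2 first.
- move=> b; apply: mE; apply: measurable_funM => //.
  exact/measurable_indicP/edge_conf_measurable.
- by move=> b w _; rewrite lee_fin mulr_ge0.
rewrite /bern_mean -sumEFin; apply: eq_bigr => b _.
under eq_integral do rewrite EFinM.
rewrite ge0_integralZl //; last 2 first.
- apply: mE; exact/measurable_indicP/edge_conf_measurable.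
- by rewrite lee_fin.
rewrite integral_indic ?setIT //; last exact: edge_conf_measurable.
by rewrite [X in (_ * X)%E](edge_conf_law b) -EFinM mulrC.
Qed.

End SbmLaw.

(** * The concentration event *)

Lemma bigminn_le (I : eqType) (r : seq I) (F : I -> nat) x a :
  a \in r -> (\big[minn/x]_(b <- r) F b <= F a)%N.
Proof.
elim: r => // b r IH; rewrite inE big_cons => /predU1P[->|/IH ar].
  exact: geq_minl.
by rewrite geq_min ar orbT.
Qed.

Lemma comm_size_sum n k (z : 'I_n -> 'I_k) :
  (\sum_(a < k) comm_size z a)%N = n.
Proof.
transitivity (\sum_(a < k) \sum_(i < n) (z i == a))%N.
  apply: eq_bigr => a _; rewrite /comm_size -sum1_card big_mkcond /=.
  by apply: eq_bigr => i _; rewrite inE; case: eqP.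
rewrite exchange_big /= -[RHS]card_ord -sum1_card; apply: eq_bigr => i _.
rewrite (bigD1 (z i)) //= eqxx big1 // => a az.
by rewrite eq_sym (negbTE az).
Qed.

Section Balance.
Context {R : realType} (n k : nat) (z : 'I_n -> 'I_k).
Hypotheses (n0 : (0 < n)%N) (k0 : (0 < k)%N).
Local Notation beta := (balance z : R).

Lemma min_comm_sizeE :
  beta * (n%:R / k%:R) = (\big[minn/n]_(a < k) comm_size z a)%:R.
Proof.
by rewrite /balance divfK // mulf_neq0 ?invr_neq0 ?pnatr_eq0 -?lt0n.
Qed.

Lemma min_comm_size_le a : beta * (n%:R / k%:R) <= (comm_size z a)%:R.
Proof. by rewrite min_comm_sizeE ler_nat bigminn_le ?mem_index_enum. Qed.

Lemma balance_le1 : beta <= 1.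
Proof.
rewrite /balance ler_pdivrMr ?divr_gt0 ?ltr0n // mul1r ler_pdivlMr ?ltr0n //.
rewrite -natrM ler_nat -[leqRHS](comm_size_sum z) -[X in (_ * X)%N]card_ord mulnC.
rewrite -sum_nat_const; apply: leq_sum => a _.
by rewrite bigminn_le ?mem_index_enum.
Qed.

Lemma balance_gt0_leq : 0 < beta -> (k <= n)%N.
Proof.
move=> b0; rewrite -[X in (_ <= X)%N](comm_size_sum z) -[X in (X <= _)%N]card_ord.
rewrite -sum1_card; apply: leq_sum => a _.
rewrite -(ltr0n R); apply: lt_le_trans (min_comm_size_le a).
by apply: mulr_gt0 => //; rewrite divr_gt0 ?ltr0n.
Qed.

End Balance.

(** The signal is constant on communities, so the mass of row [i] is repeated once for each member
    of its community. *)
Lemma signal_row_le {R : realType} (n k : nat) (z : 'I_n -> 'I_k) (p q : R)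
    (U : 'M[R]_(n, k)) lam i :
  (comm_size z (z i))%:R * enorm (row i (signal_mx (block_mx_mean z p q) U lam)) ^+ 2
  <= enorm (signal_mx (block_mx_mean z p q) U lam) ^+ 2.
Proof.
set G := signal_mx _ _ _.
have rowE j : z j = z i -> row j G = row i G.
  move=> ji; apply/rowP => b; rewrite /G /signal_mx !mul_mx_diag !mxE; congr (_ * _).
  by apply: eq_bigr => l _; rewrite !mxE ji.
rewrite [leRHS]enorm_rows [leRHS](bigID (fun j => z j == z i)) /=.
rewrite (eq_bigr (fun=> enorm (row i G) ^+ 2)) => [|j /eqP /rowE -> //].
rewrite sumr_const /comm_size cardsE -[X in _ <= X + _]mulr_natl lerDl.
by apply: sumr_ge0 => j _; exact: sqr_ge0.
Qed.

Section ConcentratedSbm.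
Context {R : realType} {d : measure_display} {T : measurableType d}.
Context (P : probability T R) (n k : nat) (z : 'I_n -> 'I_k) (p q C0 : R).
Context (A : T -> 'M[R]_n) (U : T -> 'M[R]_(n, k)).
Hypotheses (n0 : (0 < n)%N) (q0 : 0 < q) (qp : q < p) (p_half : p <= 2^-1).
Hypotheses (C00 : 0 < C0) (hA : is_sbm P z p q A).
Hypothesis hU : forall w, leading_eigenvectors (sbm_trim p (A w)) (U w).
Local Notation beta := (balance z : R).
Hypothesis beta0 : 0 < beta.

(** The summand [p] pays for the diagonal, which is [p] in [block_mx_mean] and [0] in the mean of
    [A]. *)
Definition noise_level : R := C0 * Num.sqrt (n%:R * p) + p.
(** A lower bound on the [k]-th eigenvalue of the block matrix. *)
Definition signal_level : R := (p - q) * (beta * (n%:R / k%:R)).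
(* Twice a bound on the rows of the signal. *)
Definition spread_level : R := Num.sqrt (8 * k%:R ^+ 2 / (beta * n%:R)).

Local Notation sigma := noise_level.
Local Notation L0 := signal_level.
Local Notation lo := (L0 - sigma).
Local Notation t0 := (row_threshold n k beta).
Local Notation t1 := spread_level.
Local Notation N0 := (block_mx_mean z p q).
Local Notation M := (fun w => sbm_trim p (A w)).
Local Notation F := (conc_event P C0 p A).

Hypothesis gap : 1000 * (k%:R * sigma) <= L0.

Let p0 : 0 < p := lt_trans q0 qp.

Let k0 : (0 < k)%N.
Proof. by case: (z (Ordinal n0)) => m; case: k. Qed.

Let k1 : 1 <= k%:R :> R. Proof. by rewrite ler1n. Qed.

Let beta1 : beta <= 1. Proof. exact: balance_le1. Qed.

Let nR : 0 < n%:R :> R. Proof. by rewrite ltr0n. Qed.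

Let sigma0 : 0 <= sigma.
Proof. by rewrite addr_ge0 ?mulr_ge0 ?sqrtr_ge0 // ltW. Qed.

Let nmin0 : 0 < beta * (n%:R / k%:R).
Proof. by apply: mulr_gt0 => //; rewrite divr_gt0 ?ltr0n. Qed.

Let sigmaL0 : 1000 * sigma <= L0.
Proof.
have h : sigma <= k%:R * sigma by rewrite ler_peMl.
exact: le_trans (ler_wpM2l (ler0n R 1000) h) gap.
Qed.

Let L00 : 0 < L0. Proof. by apply: mulr_gt0 => //; rewrite subr_gt0. Qed.

Lemma lo_ge : 99 / 100 * L0 <= lo.
Proof. by move: sigmaL0 L00 => h1 h2; lra. Qed.

Lemma lo_gt0 : 0 < lo.
Proof. by move: lo_ge L00 => h1 h2; lra. Qed.

Lemma mean_mxE i j : mean_mx P A i j = if i == j then 0 else N0 i j.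
Proof.
rewrite !mxE; have [<-|ij] := eqVneq i j.
  rewrite (_ : (fun w => A w i i) = cst 0); first by rewrite expectation_cst.
  by apply/funext => w; rewrite (sbm_diag hA).
have [ltij|ltji|/val_inj eij] := ltngtP i j.
- by rewrite (sbm_mean hA).
- rewrite (_ : (fun w => A w i j) = (fun w => A w j i)).
    by rewrite (sbm_mean hA) //= eq_sym.
  by apply/funext => w; rewrite -[in LHS](sbm_sym hA) mxE.
- by rewrite eij eqxx in ij.
Qed.

Lemma noise_bound w : F w ->
  forall x : 'cV[R]_n, enorm ((M w - N0) *m x) <= sigma * enorm x.
Proof.
move=> Fw x.
have -> : M w - N0 = (M w - mean_mx P A) - p%:M.
  have subE (X Y : 'M[R]_n) i j : (X - Y) i j = X i j - Y i j by rewrite !mxE.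
  apply/matrixP => i j; rewrite !subE mean_mxE [p%:M i j]mxE.
  have [<-|ij] := eqVneq i j; last by rewrite mulr0n subr0.
  by rewrite [N0 i i]mxE eqxx mulr1n subr0.
rewrite mulmxBl mul_scalar_mx; apply: le_trans (enormB _ _) _.
rewrite enormZ (ger0_norm (ltW p0)) mulrDl lerD2r.
apply: le_trans (opnorm_bound _ _) _.
by rewrite ler_wpM2r ?enorm_ge0.
Qed.

Lemma concentrated_split w : F w ->
  exists lam, spectral_split (M w) (U w) lam lo sigma.
Proof.
move=> Fw; apply: (leading_spectral_split q0 qp nmin0 _ _ _ sigma0 (noise_bound Fw) (hU w)).
- by move=> a; exact: min_comm_size_le.
- exact: (balance_gt0_leq n0 k0 beta0).
- by rewrite addrC subrK.
Qed.

Lemma spread_level_sqr : t1 ^+ 2 = 8 * k%:R ^+ 2 / (beta * n%:R).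
Proof.
by rewrite sqr_sqrtr // divr_ge0 ?mulr_ge0 ?exprn_ge0 // ltW.
Qed.

Lemma row_threshold_sqr : t0 ^+ 2 = 160 ^+ 2 * k%:R ^+ 5 / (beta ^+ 3 * n%:R).
Proof.
rewrite /row_threshold exprMn sqr_sqrtr; last by rewrite divr_ge0 ?mulr_ge0 // ltW.
have : beta * n%:R != 0 by rewrite gt_eqF // mulr_gt0.
rewrite mulf_eq0 negb_or => /andP[b0 nN0]; move: (160 : R) => c.
by field; rewrite b0 nN0.
Qed.

Lemma row_threshold_ge0 : 0 <= t0.
Proof.
have c0 : 0 <= 160 :> R by exact: ler0n.
apply: mulr_ge0; last exact: sqrtr_ge0.
apply: divr_ge0; last exact: ltW.
by apply: mulr_ge0; rewrite // exprn_ge0.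
Qed.

Lemma row_threshold_gt0 : 0 < t0.
Proof.
have c0 : 0 < 160 :> R by exact: ltr0Sn.
rewrite lt0r row_threshold_ge0 andbT -sqrf_eq0 row_threshold_sqr gt_eqF //.
by apply: divr_gt0; apply: mulr_gt0; rewrite // exprn_gt0 // ltr0n.
Qed.

Section Event.
Variables (w : T) (lam : 'rV[R]_k).
Hypotheses (Fw : F w) (split : spectral_split (M w) (U w) lam lo sigma).
Local Notation G := (signal_mx N0 (U w) lam).

Let ME : M w = N0 + (M w - N0). Proof. by rewrite addrC subrK. Qed.

Let residual_le : enorm (U w - G) <= sigma / lo * Num.sqrt k%:R.
Proof. exact: (enorm_residual split lo_gt0 ME sigma0 (noise_bound Fw)). Qed.

Let ratio_le : sigma / lo <= 1 / 100.
Proof. by rewrite ler_pdivrMr ?lo_gt0 //; move: lo_ge sigmaL0 sigma0; lra. Qed.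

Lemma signal_enorm : enorm G ^+ 2 <= 121 / 100 * k%:R.
Proof.
have [UU _ _ _] := split.
have Uk : enorm (U w) = Num.sqrt k%:R.
  by rewrite -(enorm_ortho UU) sqrtr_sqr ger0_norm ?enorm_ge0.
have sk := sqrtr_ge0 (k%:R : R).
have : enorm G <= 11 / 10 * Num.sqrt k%:R.
  have -> : G = U w - (U w - G) by rewrite opprB addrC subrK.
  apply: le_trans (enormB _ _) _; rewrite Uk.
  have := ler_wpM2r sk ratio_le; move: residual_le; lra.
move=> h; have := ler_pM (enorm_ge0 G) (enorm_ge0 G) h h.
have kk : k%:R = Num.sqrt k%:R * Num.sqrt k%:R :> R by rewrite -expr2 sqr_sqrtr.
by rewrite expr2 {3}kk; lra.
Qed.

(** Mass at most [121 / 100 * k%:R] is shared by at least [beta * (n%:R / k%:R)] equal rows. *)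
Lemma signal_row_bound i : enorm (row i G) <= t1 / 2.
Proof.
rewrite -(ler_pXn2r (n := 2)) ?nnegrE ?enorm_ge0 ?divr_ge0 ?sqrtr_ge0 //.
rewrite exprMn spread_level_sqr.
have h1 := le_trans (signal_row_le z p q (U w) lam i) signal_enorm.
have h0 : beta * (n%:R / k%:R) <= (comm_size z (z i))%:R.
  exact: min_comm_size_le.
have h2 := le_trans (ler_wpM2r (sqr_ge0 _) h0) h1.
have bn : 0 < beta * n%:R by rewrite mulr_gt0.
have kp : 0 < k%:R :> R by rewrite ltr0n.
rewrite -(ler_pM2l nmin0); apply: le_trans h2 _.
have -> : beta * (n%:R / k%:R) * (8 * k%:R ^+ 2 / (beta * n%:R) * 2^-1 ^+ 2) =
    2 * k%:R by field; rewrite !gt_eqF.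
move: k1; lra.
Qed.

(** The constant [160] enters as [(160 / 100) ^+ 2 >= 2], against the [2] coming from [t1 / 2]; the
    extra powers of [k] and [beta^-1] in [t0] only help. *)
Lemma signal_row_small i : t0 <= enorm (row i (U w)) ->
  enorm (row i G) <= 1 / 100 * enorm (row i (U w)).
Proof.
move=> ti; apply: le_trans (signal_row_bound i) _.
have : t1 / 2 <= 1 / 100 * t0; last by lra.
have t00 : 0 <= 1 / 100 * t0 by have := row_threshold_ge0; lra.
have t10 : 0 <= t1 / 2 by rewrite divr_ge0 ?sqrtr_ge0.
rewrite -(@ler_pXn2r _ 2) //.
rewrite [(t1 / 2) ^+ 2]exprMn [(1 / 100 * t0) ^+ 2]exprMn.
rewrite spread_level_sqr row_threshold_sqr.
have bn : 0 < beta * n%:R by rewrite mulr_gt0.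
have -> : 8 * k%:R ^+ 2 / (beta * n%:R) * 2^-1 ^+ 2 =
    2 * k%:R ^+ 2 * beta ^+ 2 / (beta ^+ 3 * n%:R).
  by field; rewrite !gt_eqF.
have -> : (1 / 100) ^+ 2 * (160 ^+ 2 * k%:R ^+ 5 / (beta ^+ 3 * n%:R)) =
    (160 / 100) ^+ 2 * k%:R ^+ 2 * k%:R ^+ 3 / (beta ^+ 3 * n%:R).
  by rewrite mul1r [(160 / 100) ^+ 2]exprMn; ring.
have b3n : 0 <= (beta ^+ 3 * n%:R)^-1 by rewrite invr_ge0 mulr_ge0 ?exprn_ge0 ?ltW.
rewrite ler_wpM2r //.
have k20 : 0 <= k%:R ^+ 2 :> R by exact: sqr_ge0.
have k31 : 1 <= k%:R ^+ 3 :> R by rewrite exprn_ege1.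
have b21 : beta ^+ 2 <= 1 by rewrite expr_le1 // ltW.
have := ler_wpM2l k20 k31; have := ler_wpM2l k20 b21; lra.
Qed.

(** Where a row exceeds [t1] its signal is at most half of it, so the residual makes up at least the
    other half; the total mass of the residual is at most [(sigma / lo) ^+ 2 * k%:R]. *)
Lemma concentrated_spread (J : {set 'I_n}) :
  (forall j, j \in J -> enorm (row j (U w)) < t0) ->
  spread_out t0 t1 (4 * (sigma / lo) ^+ 2 * k%:R) J (U w).
Proof.
have [UU _ _ _] := split.
move=> Jt; split; first by move=> j /Jt /ltW.
  move=> b; have := congr1 (fun X : 'M[R]_k => X b b) UU.
  rewrite !mxE eqxx => E1; rewrite -[leRHS]/(true%:R) -E1 big_mkcond /=.
  apply: ler_sum => j _; rewrite !mxE -expr2; case: ifP => // _.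
  exact: sqr_ge0.
have rs0 : 0 <= sigma / lo by rewrite divr_ge0 // ltW ?lo_gt0.
apply: (@le_trans _ _ (4 * enorm (U w - G) ^+ 2)).
  rewrite enorm_rows mulr_sumr big_mkcond /=; apply: ler_sum => j _.
  case: ifP => [/andP[_ tj]|_]; last by rewrite mulr_ge0 ?sqr_ge0.
  have h : enorm (row j (U w)) <= 2 * enorm (row j (U w - G)).
    have := enormD (row j (U w - G)) (row j G).
    rewrite -raddfD /= subrK; have := signal_row_bound j; move: tj; lra.
  have := ler_pM (enorm_ge0 _) (enorm_ge0 _) h h; rewrite !expr2; lra.
rewrite -mulrA ler_wpM2l //.
have := ler_pM (enorm_ge0 _) (enorm_ge0 _) residual_le residual_le.
rewrite -expr2 => /le_trans; apply.
by rewrite mulrACA -!expr2 sqr_sqrtr.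
Qed.

Definition trimmed : {set 'I_n} := [set i | 20 * n%:R * p <= degree (A w) i]%SET.

(** Row [i] of the trimmed matrix is zero, and an eigenvector of a positive eigenvalue vanishes on a
    zero row. *)
Lemma trimmed_row_eq0 i : i \in trimmed -> row i (U w) = 0.
Proof.
rewrite inE leNgt => /negbTE iD; have [_ MU _ lamP] := split.
apply/rowP => b; rewrite [RHS]mxE [LHS]mxE.
have := congr1 (fun X : 'M[R]_(n, k) => X i b) MU.
rewrite mul_mx_diag [RHS]mxE mxE big1 => [/esym/eqP|j _]; last first.
  by rewrite mxE iD mul0r.
rewrite mulf_eq0 => /orP[/eqP //|/eqP lb0].
by have := lt_le_trans lo_gt0 (lamP b); rewrite lb0 ltxx.
Qed.

End Event.

(** * Classes of sample points and their representatives *)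

Local Notation conf := {ffun 'I_n * 'I_n -> bool}.
Local Notation cf := (edge_conf A).
Local Notation mu := (edge_prob z p q).

Definition bad_rows (w : T) : {set 'I_n} :=
  [set i | t0 <= enorm (row i (U w))]%SET.

Definition in_class (S D : {set 'I_n}) (b : conf) (w : T) : Prop :=
  [/\ F w, bad_rows w = S, trimmed w = D & restrict_conf S D (cf w) = b].

(** [U] need not be a function of the graph, and the infimum of the norm over a class need not be
    attained; the factor [2] makes room for that. *)
Definition near_minimal (S D : {set 'I_n}) (b : conf) (w : T) : Prop :=
  in_class S D b w /\ forall w', in_class S D b w' ->
    enorm (restr S (U w)) <= 2 * enorm (restr S (U w')).

(* [b] is a graph without edges touching [S] or [D], so that the representative
   is independent of those edges. *)
Definition class_representative (S D : {set 'I_n}) (b : conf) : 'M[R]_(n, k) :=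
  if pselect (exists w, near_minimal S D b w) is left h
  then U (projT1 (cid h)) else 0.

Local Notation eta := (4 * (sigma / lo) ^+ 2 * k%:R).

Lemma class_representative_spread S D b :
  spread_out t0 t1 eta (outside S D) (class_representative S D b).
Proof.
rewrite /class_representative; case: pselect => [h|_].
  case: (cid h) => w /= [[Fw Sw _ _] _].
  have [lam split] := concentrated_split Fw.
  apply: (concentrated_spread Fw split) => j.
  by rewrite !inE negb_or -Sw inE -ltNge => /andP[].
(* The default value [0], taken when no near-minimal point exists, is spread out as well. *)
have row0 j : enorm (row j (0 : 'M[R]_(n, k))) = 0 by rewrite raddf0 enorm0.
split=> [j _|b'|].
- by rewrite row0 row_threshold_ge0.
- by rewrite big1 // => j _; rewrite mxE expr0n.
- rewrite big1 => [|j _]; last by rewrite row0 expr0n.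
  by apply: mulr_ge0 => //; apply: mulr_ge0; rewrite ?sqr_ge0.
Qed.

Lemma bad_rows_enorm w i : i \in bad_rows w ->
  t0 <= enorm (restr (bad_rows w) (U w)).
Proof.
move=> iS; apply: (@le_trans _ _ (enorm (row i (U w)))).
  by move: iS; rewrite inE.
rewrite -(ler_pXn2r (n := 2)) ?nnegrE ?enorm_ge0 // enorm_restr.
by rewrite (bigD1 i) //= lerDl sumr_ge0 // => j _; exact: sqr_ge0.
Qed.

(** A bad row [i] is shared by the whole class, so all norms are at least [t0 > 0] and some point
    comes within a factor [2] of the infimum. *)
Lemma near_minimal_exists w : F w -> bad_rows w != finset.set0 ->
  exists w', near_minimal (bad_rows w) (trimmed w)
    (restrict_conf (bad_rows w) (trimmed w) (cf w)) w'.
Proof.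
move=> Fw /set0Pn[i iS]; set S := bad_rows w; set D := trimmed w.
set b := restrict_conf S D (cf w).
pose V : set R := [set enorm (restr S (U w')) | w' in in_class S D b].
have Vt x : V x -> t0 <= x.
  move=> [w' [_ Sw' _ _] <-]; rewrite -Sw'.
  by apply: (@bad_rows_enorm w' i); rewrite Sw'.
have V0 : V !=set0 by exists (enorm (restr S (U w))); exists w.
have lbV : has_lbound V by exists t0 => x /Vt.
have infV : t0 <= inf V by exact: lb_le_inf.
have inf0 : 0 < inf V := lt_le_trans row_threshold_gt0 infV.
have [_ [w' cw' <-] w'min] := inf_adherent inf0 (conj V0 lbV).
exists w'; split => // w'' cw''.
have : inf V <= enorm (restr S (U w'')) by apply: ge_inf => //; exists w''.
lra.
Qed.

Lemma degree_adjacency w i : degree (A w) i = \sum_j adjacency (cf w) i j.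
Proof.
rewrite /degree [RHS](bigD1 i) //= -(sbm_adjacency hA) (sbm_diag hA) add0r.
by apply: eq_bigr => j _; rewrite -(sbm_adjacency hA).
Qed.

Lemma bad_not_trimmed w i : F w -> i \in bad_rows w -> i \notin trimmed w.
Proof.
move=> Fw; have [lam split] := concentrated_split Fw.
rewrite inE => ti; apply/negP => /(trimmed_row_eq0 split) Ui.
by have := lt_le_trans row_threshold_gt0 ti; rewrite Ui enorm0 ltxx.
Qed.

Lemma trim_untrimmed w i j : i \notin trimmed w -> j \notin trimmed w ->
  sbm_trim p (A w) i j = adjacency (cf w) i j.
Proof.
by rewrite !inE -!ltNge => id jd; rewrite mxE id jd /= -(sbm_adjacency hA).
Qed.

Lemma trim_trimmed w i j : (i \in trimmed w) || (j \in trimmed w) ->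
  sbm_trim p (A w) i j = 0.
Proof.
by rewrite !inE !leNgt mxE -negb_and => /negbTE ->.
Qed.

Lemma trim_sym w : (sbm_trim p (A w))^T = sbm_trim p (A w).
Proof.
apply/matrixP => i j; rewrite !mxE andbC.
by have -> : A w j i = A w i j by rewrite -[in LHS](sbm_sym hA) mxE.
Qed.

Lemma edge_meanE i j : i != j -> symmetrize mu i j = N0 i j.
Proof.
rewrite /symmetrize /edge_prob mxE /=; case: ltngtP => // [ji _|/val_inj ->].
  by rewrite eq_sym.
by rewrite eqxx.
Qed.

(** At [w] all indicators of the weight equal [1], and its exponent is [kappa] times the squared
    norm that [class_representative_large] bounds from below. *)
Lemma class_weight_large w kappa : F w -> bad_rows w != finset.set0 ->
  0 <= kappa ->
  expR (kappa * ((98 / 100 * lo) ^+ 2 * enorm (restr (bad_rows w) (U w)) ^+ 2)) <=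
  class_weight mu p kappa (bad_rows w) (trimmed w)
    (class_representative (bad_rows w) (trimmed w)
      (restrict_conf (bad_rows w) (trimmed w) (cf w))) (cf w).
Proof.
move=> Fw Sn0 kap0; set S := bad_rows w; set D := trimmed w.
set b := restrict_conf S D (cf w).
set Q := class_representative S D b.
have [w' [[Fw' Sw' Dw' bw'] w'min] QE] :
    exists2 w', near_minimal S D b w' & Q = U w'.
  rewrite /Q /class_representative; case: pselect => [h|]; last first.
    by move=> nh; case: nh; exact: near_minimal_exists.
  by case: (cid h) => w' /= w'P; exists w'.
have [lam split] := concentrated_split Fw.
have [lam' split'] := concentrated_split Fw'.
have notD i : i \in S -> i \notin D by exact: bad_not_trimmed.
set J := outside S D.
have inJ j : (j \in J) = (j \notin S) && (j \notin D).
  by rewrite finset.in_setC finset.in_setU negb_or.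
have JP j : j \in J -> (j \notin S) * (j \notin D) by rewrite inJ => /andP[].
(* An entry touching [D] is trimmed in both graphs; any other is read from an edge inside [J], where
   both graphs coincide. *)
have agree i j : i \notin S -> j \notin S -> M w i j = M w' i j.
  move=> iS jS; have [iD|iD] := boolP (i \in D).
    by rewrite !trim_trimmed // ?Dw' iD.
  have [jD|jD] := boolP (j \in D).
    by rewrite !trim_trimmed // ?Dw' jD orbT.
  have iJ : i \in J by rewrite inJ iS.
  have jJ : j \in J by rewrite inJ jS.
  rewrite !trim_untrimmed // ?Dw' // /adjacency /symmetrize.
  have bE e : e.1 \in J -> e.2 \in J -> cf w e = cf w' e.
    move=> e1 e2; have := congr1 (fun f : conf => f e) bw'.
    by rewrite /b [LHS]ffunE [RHS]ffunE e1 e2 /= => <-.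
  by rewrite !bE.
have U_supp : U w = restr S (U w) + restr J (U w).
  apply/matrixP => i l; rewrite !mxE.
  have [iS|iS] := boolP (i \in S).
    by rewrite (_ : i \in J = false) ?addr0 // inJ iS.
  have [iD|iD] := boolP (i \in D).
    rewrite (_ : i \in J = false) ?addr0; last by rewrite inJ iD andbF.
    have := trimmed_row_eq0 split iD => /rowP/(_ l).
    by rewrite !mxE.
  by rewrite (_ : i \in J = true) ?add0r // inJ iS.
have sig_lo : sigma * k%:R <= lo / 500.
  by have := lo_ge; move: gap L00; lra.
have ME v : M v = N0 + (M v - N0) by rewrite addrC subrK.
have sS i : i \in S -> enorm (row i (signal_mx N0 (U w) lam)) <=
    1 / 100 * enorm (row i (U w)).
  by rewrite inE => ti; exact: (signal_row_small Fw split).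
have sS' i : i \in S -> enorm (row i (signal_mx N0 (U w') lam')) <=
    1 / 100 * enorm (row i (U w')).
  by rewrite -Sw' inE => ti; exact: (signal_row_small Fw' split').
have Qle : enorm (restr S (U w')) <= 2 * enorm (restr S (U w)).
  by apply: w'min; split.
have big := class_representative_large split split' (trim_sym w') (ME w) (ME w')
  lo_gt0 sigma0 sig_lo (noise_bound Fw) (noise_bound Fw') agree sS sS' Qle U_supp.
rewrite -QE in big; set X := restr S (_ *m _) in big.
have devE i c : i \in S -> row_deviation mu J Q (cf w) i c = X i c.
  move=> iS; rewrite /X [RHS]mxE iS [RHS]mxE /row_deviation big_mkcond /=.
  apply: eq_bigr => j _; rewrite [restr J Q j c]mxE.
  case: ifP => [/JP jJ|_]; last by rewrite mulr0.
  rewrite [(M w - N0) i j]mxE [(- N0) i j]mxE (trim_untrimmed (notD i iS) jJ.2).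
  (* The two means differ only on the diagonal, and [S] and [J] are disjoint. *)
  rewrite edge_meanE //; apply: contraTneq iS => ->; exact: jJ.1.
have XE : enorm X ^+ 2 =
    \sum_(i in S) \sum_c row_deviation mu J Q (cf w) i c ^+ 2.
  rewrite enorm_sqr [RHS]big_mkcond /=; apply: eq_bigr => i _.
  case: ifP => iS; first by apply: eq_bigr => c _; rewrite devE.
  by rewrite big1 // => c _; rewrite mxE iS expr0n.
have -> : class_weight mu p kappa S D Q (cf w) = expR (kappa * enorm X ^+ 2).
  rewrite /class_weight big1 => [|i iD]; last first.
    by move: iD; rewrite inE degree_adjacency => ->.
  rewrite mul1r XE mulr_sumr expR_sum; apply: eq_bigr => i iS.
  rewrite (_ : (_ < _)%R = true) ?mul1r //.
  have := notD i iS; rewrite inE -ltNge degree_adjacency; apply: le_lt_trans.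
  rewrite big_mkcond /=; apply: ler_sum => j _; case: ifP => // _.
  exact: adjacency_ge0.
rewrite ler_expR ler_wpM2l // -exprMn ler_pXn2r ?nnegrE ?enorm_ge0 //.
by rewrite !mulr_ge0 ?enorm_ge0 // ltW ?lo_gt0.
Qed.

(* Chosen so that [moment_rate * signal_level ^+ 2] is [5 / 2 * snr / t0 ^+ 2]. *)
Definition moment_rate : R := 5 * beta / (2 * 160 ^+ 2 * k%:R ^+ 3 * p).
Definition snr : R := n%:R * (p - q) ^+ 2 / p.

Local Notation kappa := moment_rate.
Local Notation s := snr.

Let snr0 : 0 < s.
Proof. by rewrite divr_gt0 ?mulr_gt0 ?exprn_gt0 // subr_gt0. Qed.

Lemma moment_rate_ge0 : 0 <= kappa.
Proof.
have c0 : 0 <= 160 :> R by exact: ler0n.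
have b0 := ltW beta0; have p0' := ltW p0.
apply: divr_ge0; first by apply: mulr_ge0.
by apply: mulr_ge0 => //; apply: mulr_ge0; rewrite ?mulr_ge0 ?exprn_ge0.
Qed.

(** [2] is [8 / 10] of [5 / 2], while the square of [98 / 100 * (99 / 100)] exceeds [8 / 10]. *)
Lemma moment_rate_snr : 2 * s / t0 ^+ 2 <= kappa * (98 / 100 * lo) ^+ 2.
Proof.
have kp : 0 < k%:R :> R by rewrite ltr0n.
have E1 : 2 * s / t0 ^+ 2 = 8 / 10 * (kappa * L0 ^+ 2).
  rewrite row_threshold_sqr /snr /moment_rate /signal_level.
  have : 160 != 0 :> R by rewrite pnatr_eq0.
  have b0 : beta != 0 by rewrite gt_eqF.
  move: (160 : R) (beta : R) b0 => c b b0 c0.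
  by field; rewrite b0 c0 !gt_eqF.
rewrite E1 [leRHS](_ : _ = (98 / 100) ^+ 2 * (kappa * lo ^+ 2)); last by ring.
have L00' := ltW L00.
have lo2 : (99 / 100 * L0) ^+ 2 <= lo ^+ 2.
  have l1 : 0 <= 99 / 100 * L0 by lra.
  have l2 := ltW lo_gt0.
  rewrite (@ler_pXn2r _ 2) //; exact: lo_ge.
have := ler_wpM2l moment_rate_ge0 lo2.
have := mulr_ge0 moment_rate_ge0 (sqr_ge0 L0).
have -> : kappa * (99 / 100 * L0) ^+ 2 = (99 / 100) ^+ 2 * (kappa * L0 ^+ 2).
  by ring.
move: (kappa * L0 ^+ 2) (kappa * lo ^+ 2) => u v u0 uv.
rewrite !expr2 in uv *; lra.
Qed.

Hypothesis tail_small : 8 * (4 * k%:R * kappa) * p * eta *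
  expR (42 * (4 * k%:R * kappa) * n%:R * p * t0 ^+ 2) <= 1.

(** [t1 ^+ 2] cancels every parameter in the exponent and leaves [42 * 80 / 160 ^+ 2], below [1];
    the prefactor is at most [1 / 100], and [expR 1 <= 4]. *)
Let body_small : 8 * (4 * k%:R * kappa) * p *
  expR (42 * (4 * k%:R * kappa) * n%:R * p * t1 ^+ 2) <= 1.
Proof.
have kp : 0 < k%:R :> R by rewrite ltr0n.
have b0 : beta != 0 by rewrite gt_eqF.
have c100 : 100 <= 160 :> R by rewrite ler_nat.
have -> : 42 * (4 * k%:R * kappa) * n%:R * p * t1 ^+ 2 = 42 * 80 / 160 ^+ 2.
  rewrite spread_level_sqr /moment_rate; move: (beta : R) b0 => b b0.
  have : 160 != 0 :> R by rewrite pnatr_eq0.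
  move: (160 : R) => c c0; by field; rewrite b0 c0 !gt_eqF.
have -> : 8 * (4 * k%:R * kappa) * p = 80 * beta / (160 ^+ 2 * k%:R ^+ 2).
  rewrite /moment_rate; move: (beta : R) => b.
  have : 160 != 0 :> R by rewrite pnatr_eq0.
  move: (160 : R) => c c0; by field; rewrite c0 !gt_eqF.
move: (160 : R) c100 => c c100.
have c0 : 0 < c by lra.
have c2 : 100 * 100 <= c ^+ 2 by rewrite expr2 ler_pM.
have c20 : 0 < c ^+ 2 by rewrite exprn_gt0.
have e1 : expR (42 * 80 / c ^+ 2) <= 4 :> R.
  apply: le_trans expR1_le4; rewrite ler_expR ler_pdivrMr // mul1r; lra.
have k21 : 1 <= k%:R ^+ 2 :> R by rewrite exprn_ege1.
have h : 80 * beta / (c ^+ 2 * k%:R ^+ 2) <= 1 / 100.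
  rewrite ler_pdivrMr ?mulr_gt0 ?exprn_gt0 //.
  have := ler_wpM2l (ltW c20) k21; move: beta1 c2; lra.
have h0 : 0 <= 80 * beta / (c ^+ 2 * k%:R ^+ 2).
  apply: divr_ge0; first by apply: mulr_ge0; rewrite // ltW.
  by rewrite mulr_ge0 ?exprn_ge0 // ltW.
have := ler_pM h0 (expR_ge0 _) h e1; lra.
Qed.

Hypothesis snr_large : 2 * (8 * expR 4 * k%:R + 1) <= s.

(** * Bound on the mean bad mass *)

Local Notation x := (expR (- (3 * n%:R * (p - q) ^+ 2 / (2 * p)))).
Local Notation Y := (class_sum mu p kappa class_representative x).
Local Notation h := (n%:R * (x * (8 * expR 4 * k%:R) + expR (- (12 * n%:R * p)))).

Let pR0 : p != 0. Proof. by rewrite gt_eqF. Qed.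

Let xE : x = expR (- (3 / 2 * s)).
Proof. by congr expR; rewrite /snr; field. Qed.

Definition bad_mass (w : T) : R :=
  \sum_(i < n) enorm (row i (U w)) ^+ 2 * (t0 <= enorm (row i (U w)))%R%:R.

Lemma bad_massE w : bad_mass w = enorm (restr (bad_rows w) (U w)) ^+ 2.
Proof.
rewrite enorm_restr [RHS]big_mkcond /=; apply: eq_bigr => i _.
by rewrite inE; case: (t0 <= _); rewrite ?mulr1 ?mulr0.
Qed.

(** The exponential is compared with its tangent at [h], the logarithm of the bound on the mean of
    [Y], so that the bracket has mean at most [h]; the factor in front converts the exponent back
    into bad mass. *)
Let majorant (b : conf) : R := 2 * t0 ^+ 2 / s * (h - 1 + expR (- h) * Y b).

Let tangent (u v : R) : u <= v - 1 + expR (- v) * expR u.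
Proof. by have := expR_ge1Dx (u - v); rewrite expRD mulrC; lra. Qed.

Let scale_ge0 : 0 <= 2 * t0 ^+ 2 / s.
Proof.
apply: divr_ge0; last exact: ltW.
by apply: mulr_ge0 => //; exact: sqr_ge0.
Qed.

Let majorant_ge0 b : 0 <= majorant b.
Proof.
rewrite mulr_ge0 //; apply: le_trans (tangent 0 h) _.
rewrite lerD2l ler_wpM2l ?expR_ge0 // expR0.
apply: class_sum_ge1; exact: expR_ge0.
Qed.

(** In units of [s * (W / t0 ^+ 2)], the class weight gains [2] by [moment_rate_snr], and
    [x ^+ #|S|] costs at most [3 / 2] since each bad row has mass at least [t0 ^+ 2]; the surplus
    [1 / 2] is [u]. *)
Let bad_mass_le w : bad_mass w * \1_F w <= majorant (cf w).
Proof.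
rewrite indicE; have [/set_mem Fw|_] := boolP (w \in F); last by rewrite mulr0.
rewrite mulr1 bad_massE; set S := bad_rows w.
have [S0|Sn0] := eqVneq S finset.set0.
  rewrite (_ : _ ^+ 2 = 0) // enorm_restr big1 // => i.
  by rewrite S0 inE.
set W := enorm _ ^+ 2.
have t02 : 0 < t0 ^+ 2 by rewrite exprn_gt0 // row_threshold_gt0.
have cardS : #|S|%:R <= W / t0 ^+ 2.
  rewrite ler_pdivlMr // mulr_natl -sumr_const /W enorm_restr.
  apply: ler_sum => i; rewrite inE => ti.
  by rewrite ler_pXn2r ?nnegrE ?enorm_ge0 ?row_threshold_ge0.
have W0 : 0 <= W by exact: sqr_ge0.
pose u := s / 2 * (W / t0 ^+ 2).
suff uY : expR u <= Y (cf w).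
  rewrite (_ : W = 2 * t0 ^+ 2 / s * u); last first.
    by rewrite /u; field; rewrite !gt_eqF // row_threshold_gt0.
  rewrite ler_wpM2l //; apply: le_trans (tangent u h) _.
  by rewrite lerD2l ler_wpM2l ?expR_ge0.
have SD : S :&: trimmed w = finset.set0.
  apply/eqP; rewrite -finset.subset0; apply/fintype.subsetP => i.
  by rewrite inE => /andP[/(bad_not_trimmed Fw)/negbTE ->].
have := class_sum_ge mu p kappa class_representative (cf w) (expR_ge0 _) SD.
move=> /(_ (- (3 * n%:R * (p - q) ^+ 2 / (2 * p)))); apply: le_trans.
apply: le_trans (ler_wpM2l (exprn_ge0 _ (expR_ge0 _))
  (class_weight_large Fw Sn0 moment_rate_ge0)).
rewrite -/S -/W xE -expRM_natl -expRD ler_expR /u.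
have := ler_wpM2r W0 moment_rate_snr.
have := ler_wpM2l (ltW snr0) cardS.
have -> : 2 * s / t0 ^+ 2 * W = 2 * (s * (W / t0 ^+ 2)) by ring.
lra.
Qed.

(** Since [s <= n%:R * p], the trimming term is at most [x], so [h] is at most [n%:R * x] times a
    constant, which [snr_large] absorbs through the factor [2 / s]. *)
Let majorant_mean : bern_mean mu majorant <= t0 ^+ 2 * n%:R * x.
Proof.
have p1 : p <= 1 by move: p_half; lra.
have mu01 := @edge_prob01 _ n k z p q q0 qp p1.
have mup (e : 'I_n * 'I_n) : (e.1 < e.2)%N -> mu e <= p.
  by move=> eu; rewrite /edge_prob eu; case: ifP => // _; exact: ltW.
have muo (e : 'I_n * 'I_n) : ~~ (e.1 < e.2)%N -> mu e = 0.
  by move=> /negbTE eu; rewrite /edge_prob eu.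
have t1_ge0 : 0 <= t1 by exact: sqrtr_ge0.
have Ymean := class_sum_mean mu01 mup muo (ltW p0) k0 row_threshold_ge0 t1_ge0
  moment_rate_ge0 class_representative_spread body_small tail_small
  (expR_ge0 (- (3 * n%:R * (p - q) ^+ 2 / (2 * p)))).
rewrite /majorant bern_meanZ bern_meanD bern_mean_cst.
rewrite bern_meanZ.
apply: (@le_trans _ _ (2 * t0 ^+ 2 / s * h)).
  rewrite ler_wpM2l // -lerBrDl opprB addrCA subrr addr0.
  rewrite expRN mulrC ler_pdivrMr ?expR_gt0 // mul1r.
  exact: Ymean.
have sle : s <= n%:R * p.
  rewrite /snr ler_pdivrMr // -mulrA ler_wpM2l // -expr2.
  by rewrite ler_pXn2r ?nnegrE ?subr_ge0 ?(ltW p0) ?(ltW qp) // gerBl ltW.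
have yx : expR (- (12 * n%:R * p)) <= x.
  by rewrite xE ler_expR; move: sle snr0; lra.
have hx : h <= n%:R * x * (8 * expR 4 * k%:R + 1).
  rewrite -[leRHS]mulrA ler_wpM2l // mulrDr mulr1 lerD2l.
  exact: yx.
have t20 : 0 <= t0 ^+ 2 by exact: sqr_ge0.
have nx : 0 <= n%:R * x by rewrite mulr_ge0 ?expR_ge0.
apply: le_trans (ler_wpM2l scale_ge0 hx) _.
have -> : 2 * t0 ^+ 2 / s * (n%:R * x * (8 * expR 4 * k%:R + 1)) =
    t0 ^+ 2 * (n%:R * x) * (2 * (8 * expR 4 * k%:R + 1) / s).
  by field; rewrite gt_eqF.
rewrite -[leRHS]mulr1 -[in leRHS](mulrA (t0 ^+ 2)).
apply: ler_wpM2l; first exact: mulr_ge0.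
by rewrite ler_pdivrMr // mul1r.
Qed.

Lemma bad_mass_expectation :
  ('E_P[fun w => (bad_mass w * \1_F w)%R] <= (t0 ^+ 2 * n%:R * x)%:E)%E.
Proof.
have bm0 w : 0 <= bad_mass w * \1_F w.
  by rewrite bad_massE mulr_ge0 ?sqr_ge0.
apply: (@le_trans _ _ ('E_P[fun w => majorant (cf w)])%E).
  (* Monotonicity is taken from the definition of the integral as a supremum over simple functions
     below the integrand. *)
  rewrite unlock ge0_integralTE => [|w]; last by rewrite lee_fin.
  rewrite ge0_integralTE => [|w]; last by rewrite lee_fin.
  apply: le_ereal_sup => _ [f /= fle <-]; exists f => // w.
  by apply: le_trans (fle w) _; rewrite lee_fin.
by rewrite (edge_conf_expectation hA) // lee_fin; exact: majorant_mean.
Qed.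

End ConcentratedSbm.

(** All smallness conditions become lower bounds on [s] that depend only on [C0] and on a common
    bound [L] for [k] and [beta^-1]. *)
Lemma bad_mass_expectation_le {R : realType} {d : measure_display}
    {T : measurableType d} (P : probability T R) (n k : nat)
    (z : 'I_n -> 'I_k) (p q C0 L : R) (A : T -> 'M[R]_n) (U : T -> 'M[R]_(n, k)) :
  let beta : R := balance z in
  let s := n%:R * (p - q) ^+ 2 / p in
  (0 < n)%N -> 0 < q -> q < p -> p <= 2^-1 -> 0 < C0 -> is_sbm P z p q A ->
  (forall w, leading_eigenvectors (sbm_trim p (A w)) (U w)) -> 0 < beta ->
  beta^-1 <= L -> k%:R <= L ->
  (1000 * L ^+ 3 * (C0 + 1)) ^+ 2 <= s ->
  16 * (C0 + 1) ^+ 2 * L ^+ 5 * expR (420 * L ^+ 5) <= s ->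
  2 * (8 * expR 4 * L + 1) <= s ->
  ('E_P[fun w => (bad_mass z U w * \1_(conc_event P C0 p A) w)%R] <=
    (row_threshold n k beta ^+ 2 * n%:R *
     expR (- (3 * n%:R * (p - q) ^+ 2 / (2 * p))))%:E)%E.
Proof.
move=> beta s n0 q0 qp p_half C00 hA hU beta0 betaL kL.
have p0 : 0 < p := lt_trans q0 qp.
have nR : 0 < n%:R :> R by rewrite ltr0n.
have k0 : (0 < k)%N by case: (z (Ordinal n0)) => m; case: (k).
have kR : 0 < k%:R :> R by rewrite ltr0n.
have k1 : 1 <= k%:R :> R by rewrite ler1n.
have beta1 : beta <= 1 by exact: balance_le1.
have L1 : 1 <= L := le_trans k1 kL.
have L0 : 0 <= L by lra.
have C10 : 0 <= C0 + 1 by lra.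
have np0 : 0 <= n%:R * p by rewrite mulr_ge0 // ltW.
set r := Num.sqrt (n%:R * p).
have r0 : 0 < r by rewrite sqrtr_gt0 mulr_gt0.
have rr : r ^+ 2 = n%:R * p by rewrite sqr_sqrtr.
have sp0 : 0 < s by rewrite divr_gt0 ?mulr_gt0 ?exprn_gt0 ?subr_gt0.
set t := Num.sqrt s.
have t0 : 0 < t by rewrite sqrtr_gt0.
have tt : t ^+ 2 = s by rewrite sqr_sqrtr // ltW.
have tr : t * r = n%:R * (p - q).
  rewrite /t /r -sqrtrM; last exact: ltW.
  have -> : s * (n%:R * p) = (n%:R * (p - q)) ^+ 2.
    by rewrite /s; field; rewrite gt_eqF.
  by rewrite sqrtr_sqr ger0_norm // mulr_ge0 // subr_ge0 ltW.
have L30 : 0 <= L ^+ 3 by rewrite exprn_ge0.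
have K10 : 0 <= 1000 * L ^+ 3 * (C0 + 1).
  exact: mulr_ge0 (mulr_ge0 (ler0n R 1000) L30) C10.
move=> s1.
have Kt : 1000 * L ^+ 3 * (C0 + 1) <= t.
  rewrite -(ler_pXn2r (ltn0Sn 1) K10 (ltW t0)) tt; exact: s1.
clear s1.
have noise : noise_level n p C0 <= (C0 + 1) * r.
  rewrite /noise_level -/r mulrDl mul1r lerD2l.
  rewrite -(@ler_pXn2r _ 2) ?nnegrE ?(ltW p0) ?(ltW r0) // rr expr2.
  rewrite ler_wpM2r ?(ltW p0) //.
  have : 1 <= n%:R :> R by rewrite ler1n.
  lra.
have noise0 : 0 <= noise_level n p C0.
  by rewrite /noise_level addr_ge0 ?mulr_ge0 ?sqrtr_ge0 ?ltW.
have kb : k%:R / beta <= L ^+ 2.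
  by rewrite expr2 ler_pM // invr_ge0 ltW.
have kb0 : 0 < k%:R / beta by exact: divr_gt0.
have signal : signal_level z p q * (k%:R / beta) = t * r.
  by rewrite tr /signal_level -/beta; field; rewrite !gt_eqF.
have signalL : t * r <= signal_level z p q * L ^+ 2.
  rewrite -signal ler_wpM2l // -(ler_pM2r kb0) mul0r signal.
  by rewrite mulr_ge0 // ltW.
(* The signal is at least [t * r / L ^+ 2] and the noise at most [(C0 + 1) * r], so [Kt]
   suffices. *)
have gap : 1000 * (k%:R * noise_level n p C0) <= signal_level z p q.
  have L20 : 0 < L ^+ 2 by rewrite exprn_gt0 //; lra.
  rewrite -(ler_pM2r L20); apply: le_trans signalL.
  apply: le_trans (ler_wpM2r (ltW r0) Kt).
  have h := ler_pM (ler0n R k) noise0 kL noise.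
  have -> : 1000 * L ^+ 3 * (C0 + 1) * r = 1000 * (L * ((C0 + 1) * r)) * L ^+ 2.
    by move: (1000 : R) => c; ring.
  rewrite ler_wpM2r ?(ltW L20) //.
  exact: (ler_wpM2l (ler0n R 1000) h).
move=> s2 s3; apply: (bad_mass_expectation n0 q0 qp p_half C00 hA hU beta0 gap).
- move: s2; clear s3; have lo_ge2 := lo_ge n0 q0 qp C00 beta0 gap.
  have lo_gt := lo_gt0 n0 q0 qp C00 beta0 gap.
  clear gap Kt K10 kb kb0 signal.
  set lo := signal_level z p q - noise_level n p C0 in lo_ge2 lo_gt *.
  (* The noise-to-signal ratio is of order [1 / t], which makes the tail mass of order [1 / s]. *)
  have ratio : noise_level n p C0 / lo * t <= 2 * (C0 + 1) * L ^+ 2.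
    rewrite mulrAC ler_pdivrMr //.
    have h1 := ler_wpM2r (ltW t0) noise.
    have h2 := ler_wpM2l C10 signalL.
    have h3 : (C0 + 1) * L ^+ 2 * (99 / 100 * signal_level z p q) <=
        (C0 + 1) * L ^+ 2 * lo.
      by rewrite ler_wpM2l ?mulr_ge0 ?exprn_ge0.
    have h4 : 0 <= (C0 + 1) * L ^+ 2 * lo.
      by rewrite !mulr_ge0 ?exprn_ge0 // ltW.
    lra.
  have ratio0 : 0 <= noise_level n p C0 / lo * t.
    by rewrite mulr_ge0 ?divr_ge0 // ltW.
  have ratio2 : (noise_level n p C0 / lo) ^+ 2 * s <= 4 * (C0 + 1) ^+ 2 * L ^+ 4.
    rewrite -tt -exprMn.
    have -> : 4 * (C0 + 1) ^+ 2 * L ^+ 4 = (2 * (C0 + 1) * L ^+ 2) ^+ 2 by ring.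
    by rewrite ler_pXn2r ?nnegrE // !mulr_ge0 ?exprn_ge0.
  have b_neq0 : beta != 0 by rewrite gt_eqF.
  (* At level [t0] the exponent keeps [k] and [beta]; it is at most [420 * L ^+ 5], and the small
     tail mass compensates for it. *)
  have e1 : 42 * (4 * k%:R * moment_rate z p) * n%:R * p *
      row_threshold n k beta ^+ 2 = 420 * (k%:R ^+ 3 * (beta^-1) ^+ 2).
    rewrite (row_threshold_sqr n0 beta0) /moment_rate -/beta.
    have : 160 != 0 :> R by rewrite pnatr_eq0.
    move: (160 : R) (beta) b_neq0 => c b b0 c0.
    by field; rewrite b0 c0 !gt_eqF.
  have e2 : 8 * (4 * k%:R * moment_rate z p) * p = 80 * beta / (160 ^+ 2 * k%:R ^+ 2).
    rewrite /moment_rate -/beta; have : 160 != 0 :> R by rewrite pnatr_eq0.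
    move: (160 : R) (beta) => c b c0.
    by field; rewrite c0 !gt_eqF.
  rewrite e1 e2.
  have a1 : 80 * beta / (160 ^+ 2 * k%:R ^+ 2) <= 1.
    have c100 : 100 <= 160 :> R by rewrite ler_nat.
    move: (160 : R) c100 => c c100.
    have c0 : 0 < c by lra.
    have c2 : 100 * 100 <= c ^+ 2 by rewrite expr2 ler_pM.
    have c20 : 0 < c ^+ 2 by rewrite exprn_gt0.
    rewrite ler_pdivrMr ?mulr_gt0 ?exprn_gt0 // mul1r.
    have k21 : 1 <= k%:R ^+ 2 :> R by rewrite exprn_ege1.
    have := ler_wpM2l (ltW c20) k21; lra.
  have a10 : 0 <= 80 * beta / (160 ^+ 2 * k%:R ^+ 2).
    apply: divr_ge0; first by apply: mulr_ge0 => //; exact: ltW.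
    by apply: mulr_ge0; exact: sqr_ge0.
  have a2 : expR (420 * (k%:R ^+ 3 * (beta^-1) ^+ 2)) <= expR (420 * L ^+ 5).
    rewrite ler_expR; apply: ler_wpM2l; first exact: ler0n.
    rewrite (exprD L 3 2); apply: ler_pM.
    - by rewrite exprn_ge0.
    - exact: sqr_ge0.
    - by rewrite lerXn2r ?nnegrE.
    - by rewrite lerXn2r ?nnegrE ?invr_ge0 ?(ltW beta0).
  move: (expR (420 * L ^+ 5)) (expR_ge0 (420 * L ^+ 5)) a2 => e e0 a2 s2.
  have eta_le : 4 * (noise_level n p C0 / lo) ^+ 2 * k%:R * e <= 1.
    rewrite -(ler_pM2r sp0) mul1r; apply: le_trans s2.
    have h := ler_pM (mulr_ge0 (sqr_ge0 (noise_level n p C0 / lo)) (ltW sp0))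
      (ler0n R k) ratio2 kL.
    have := ler_wpM2l e0 h.
    lra.
  have x0 : 0 <= 4 * (noise_level n p C0 / lo) ^+ 2 * k%:R.
    by apply: mulr_ge0 => //; apply: mulr_ge0; rewrite ?sqr_ge0.
  have := ler_pM (mulr_ge0 a10 x0) (expR_ge0 _) (ler_pM a10 x0 a1 (lexx _)) a2.
  rewrite mul1r => h; exact: le_trans h eta_le.
- rewrite /snr -/s; apply: le_trans s3; rewrite ler_wpM2l // lerD2r.
  by rewrite ler_wpM2l // mulr_ge0 ?expR_ge0.
Qed.

Theorem theorem3 (R : realType) (C0 : R) (hC0 : concentration_constant C0)
    (k : nat -> nat) (z : forall n : nat, 'I_n -> 'I_(k n)) (p q : nat -> R)
    (d : nat -> measure_display) (T : forall n : nat, measurableType (d n))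
    (P : forall n : nat, probability (T n) R)
    (A : forall n : nat, T n -> 'M[R]_n)
    (U : forall n : nat, T n -> 'M[R]_(n, k n))
    (beta := fun n : nat => balance (z n) : R)
    (t0 := fun n : nat => row_threshold n (k n) (beta n) : R)
    (hA : forall n : nat, is_sbm (P n) (z n) (p n) (q n) (A n))
    (hUmeas : forall n : nat, random_matrix (U n))
    (hU : forall (n : nat) (w : T n),
        leading_eigenvectors (sbm_trim (p n) (A n w)) (U n w))
    (hbeta0 : \forall n \near \oo, 0 < beta n)
    (hbeta : (fun n : nat => (beta n)^-1%R : R^o) =O_\oo (fun _ : nat => 1%R : R^o))
    (hk : (fun n : nat => (k n)%:R%R : R^o) =O_\oo (fun _ : nat => 1%R : R^o))
    (hpq : forall n : nat, [/\ 0 < q n, q n < p n & p n <= 2^-1])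
    (hsnr : n%:R * (p n - q n) ^+ 2 / p n @[n --> \oo] --> +oo) :
  \forall n \near \oo,
    ('E_(P n)[fun w : T n =>
        ((\sum_(i < n) enorm (row i (U n w)) ^+ 2
                       * (t0 n <= enorm (row i (U n w)))%R%:R)
         * \1_(conc_event (P n) C0 (p n) (A n)) w)%R]
     <= (t0 n ^+ 2 * n%:R
         * expR (- (3 * n%:R * (p n - q n) ^+ 2 / (2 * p n))))%:E)%E.
Proof.
have [C00 _] := hC0.
have [L1 hL1] : exists L1, \forall n \near \oo, (beta n)^-1 <= L1.
  move/eqO_exP: hbeta => [c _ hc]; exists c; apply: filterS hc => n.
  by rewrite normr1 mulr1; apply: le_trans; exact: ler_norm.
have [L2 hL2] : exists L2, \forall n \near \oo, (k n)%:R <= L2 :> R.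
  move/eqO_exP: hk => [c _ hc]; exists c; apply: filterS hc => n.
  by rewrite normr1 mulr1; apply: le_trans; exact: ler_norm.
pose L := Num.max L1 L2.
move/cvgryPge: hsnr => hsnr.
near=> n.
have [q0 qp p_half] := hpq n.
apply: (@bad_mass_expectation_le _ _ _ _ _ _ _ _ _ _ L) => //.
- by near: n; exists 1%N.
- by near: n.
- by rewrite le_max; apply/orP; left; near: n.
- by rewrite le_max; apply/orP; right; near: n.
(* The three remaining lower bounds are constants in [n], while the signal-to-noise ratio
   diverges. *)
- by near: n; exact: hsnr.
- by near: n; exact: hsnr.
- by near: n; exact: hsnr.
Unshelve. all: by end_near.
Qed.
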